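(* Any 4-dimensional real Lie algebra can be realized as an algebra of affine vector fields in a domain in $\mathbb{C}^3$, linearly independent (over $\mathbb{R}$) at each point. That is, for every 4-dimensional real Lie algebra $\mathfrak{g}$ there are a domain $D\subset\mathbb{C}^3$ and an injective real Lie algebra homomorphism from $\mathfrak{g}$ to the Lie algebra of affine vector fields on $D$ such that the images of a basis of $\mathfrak{g}$ are linearly independent over $\mathbb{R}$ at each point of $D$.
   Context: An affine vector field on $\mathbb{C}^3$ is a holomorphic vector field $\sum_{j=1}^3 f_j\frac{\partial}{\partial z_j}$ (equivalently, the real field $2\,\mathrm{Re}\sum_j f_j\frac{\partial}{\partial z_j}$) whose coefficients $f_j$ are complex polynomials of degree at most 1 in $(z_1,z_2,z_3)$; such fields form a real Lie algebra under the Lie bracket of vector fields. *)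

(* Defs.v *)
From HB Require Import structures.
From mathcomp Require Import all_boot all_order all_algebra.
From mathcomp Require Import complex.
From mathcomp Require Import all_classical all_reals all_analysis.

Set Implicit Arguments.
Unset Strict Implicit.
Unset Printing Implicit Defensive.

Import Order.TTheory GRing.Theory Num.Theory.
Import numFieldNormedType.Exports.
Local Open Scope classical_set_scope.
Local Open Scope complex_scope.
Local Open Scope ring_scope.

Definition is_lie_bracket (R : fieldType) (g : lmodType R)
    (br : g -> g -> g) : Prop :=
  [/\ bilinear_for *:%R *:%R br,
      forall x, br x x = 0 &
      forall x y z, br x (br y z) + br y (br z x) + br z (br x y) = 0].

(* The following notions are stated over an arbitrary normed field K, because
   the topology of 'rV[K]_n is found by type inference only when the entries
   are presented as a [numFieldType]; they are used with K = R[i], n = 3. *)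
Section VectorFields.
Variables (K : numFieldType) (n : nat).
Implicit Types (D : set 'rV[K]_n) (X Y : 'rV[K]_n -> 'rV[K]_n).

Definition is_domain D : Prop := [/\ D !=set0, open D & connected D].

(* A field sum_j f_j d/dz_j is represented by z |-> (f_j(z))_j.  As a field on
   D it is determined by its values on D: the values elsewhere are junk. *)
Definition affine_field_on D X : Prop :=
  forall j : 'I_n, exists (b : K) (a : 'I_n -> K),
    forall z, D z -> X z 0 j = b + \sum_(k < n) a k * z 0 k.

(* The j-th coefficient is sum_k (X_k dY_j/dz_k - Y_k dX_j/dz_k); for K = R[i]
   the derivatives are complex ones. *)
Definition field_bracket X Y : 'rV[K]_n -> 'rV[K]_n :=
  fun z => 'D_(X z) Y z - 'D_(Y z) X z.

End VectorFields.

(* An injective homomorphism of real Lie algebras from (g, br) to the affine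
   fields on D, two fields on D being equal when they agree on D. *)
Definition affine_field_embedding (R : realType) (g : lmodType R)
    (br : g -> g -> g) (D : set 'rV[R[i]]_3)
    (phi : g -> 'rV[R[i]]_3 -> 'rV[R[i]]_3) : Prop :=
  [/\ forall x, affine_field_on D (phi x),
      forall (t : R) x y z, D z ->
        phi (t *: x + y) z = t%:C *: phi x z + phi y z,
      forall x y z, D z ->
        phi (br x y) z = field_bracket (phi x) (phi y) z &
      forall x y, (forall z, D z -> phi x z = phi y z) -> x = y].

Definition real_independent (R : realType) (m n : nat)
    (v : 'I_m -> 'rV[R[i]]_n) : Prop :=
  forall c : 'I_m -> R, \sum_(i < m) (c i)%:C *: v i = 0 -> forall i, c i = 0.

(* Main.v *)
Require Import Defs.
From HB Require Import structures.
From mathcomp Require Import all_boot all_order all_algebra.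
From mathcomp Require Import complex.
From mathcomp Require Import all_classical all_reals all_analysis.
From mathcomp Require Import ring lra zify.
Import Order.TTheory GRing.Theory Num.Theory.
Import numFieldNormedType.Exports.
Local Open Scope classical_set_scope.
Local Open Scope complex_scope.
Local Open Scope ring_scope.
Set Implicit Arguments.
Unset Strict Implicit.
Unset Printing Implicit Defensive.

(** Let g be the Lie algebra. An affine action of g on C^3 consists of a linear
part rho (a representation) and a translation part b, which is a cocycle:
b [x, y] = x.b(y) - y.b(x). At the origin the field attached to x is b(x), up to
sign, so the fields are independent there as soon as b is injective over R, and
then they stay so on a small polydisc, injectivity being an open condition. It
is enough to take for rho the complexification of a real representation W of
dimension 3; then b = b1 + i b2 for two real cocycles b1, b2 : g -> W, and the
condition becomes ker b1 :&: ker b2 = 0. This reduces the theorem to a question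
of real linear algebra, the predicate [realizable]; the passage back is
[affine_fields_of_cocycles].

The question is answered by following the structure of g. First, g is never
perfect ([exists_character]). If the trace of ad is not zero, it is a character
of g. If it is zero, g is unimodular, so the Chevalley-Eilenberg differential
vanishes on 3-forms, and d alpha /\ d beta = d (alpha /\ d beta) = 0 for all 1-forms
alpha and beta. Were g perfect, d would embed the 1-forms as a space of
dimension 4, totally isotropic in the 2-forms for the wedge product, which is a
nondegenerate quadratic form on a space of dimension 6: impossible.

So g has an ideal h of dimension 3 containing [g, g], the kernel of a character
chi, and the representation W is always carried by such an ideal, with one of
three actions.
- Adjoint action ([realizable_of_derivation]). If h is abelian or a Heisenberg
  algebra, b1 is a derivation g -> h which is injective on h (a projection, or
  the grading of the Heisenberg algebra), and b2 = chi v with v central in h.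
- Adjoint action composed with a projection ([realizable_of_grading]). If [g, g]
  lies in an abelian ideal k of dimension 2, then g / k acts on k by two commuting
  2 x 2 matrices, and some combination of these is scalar. If that scalar is 0,
  g has an abelian ideal of dimension 3; otherwise an element u acts on k as the
  identity, so that ad u is both a derivation and a projection onto k.
- Adjoint action twisted by a multiple of chi ([realizable_of_simple]). If h is
  perfect, b1 and b2 are the coboundaries of two vectors of h in general
  position.
Every other solvable h reduces to these: it is the sum of a line R e1 and an
abelian ideal k of dimension 2. If e1 acts on k without being nilpotent, then
all of [g, g] is forced into k; if it acts nilpotently, h is abelian or a
Heisenberg algebra ([realizable_of_solvable]). *)

(** * Small polydiscs *)

(** A ball about 0 is the union of the segments joining 0 to its points. The scalars
of these segments live in R, whence the embedding [c] of R in the ground field. *)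
Lemma ball0_connected (R : realType) (K : numFieldType) (c : {rmorphism R -> K})
    (n : nat) (e : K) :
    (forall t, `|c t| = c `|t|) -> {homo c : s t / s < t} ->
    (forall d : K, 0 < d -> exists2 r : R, 0 < r & c r <= d) -> 0 < e ->
  connected (ball (0 : 'rV[K]_n) e).
Proof.
move=> c_norm c_lt c_small e0.
have cc : continuous c.
  move=> t; apply/cvgrPdist_lt => d /c_small[r r0 crd]; near=> s.
  rewrite -rmorphB c_norm; apply: lt_le_trans crd; apply: c_lt.
  by near: s; exact: (@cvgrPdist_lt _ _ _ _ (nbhs_filter t) id t).1.
have -> : ball (0 : 'rV[K]_n) e = \bigcup_(z in ball (0 : 'rV[K]_n) e)
    ((fun t => c t *: z) @` `[0, 1]).
  apply/seteqP; split => [z bz|z [y yb [t /= t01 <-]]].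
    by exists z => //; exists 1; rewrite ?rmorph1 ?scale1r //= in_itv /= lexx ler01.
  move: yb; rewrite -!ball_normE /= !sub0r !normrN normrZ => yb.
  apply: le_lt_trans yb; rewrite ler_piMl // c_norm.
  move: t01; rewrite in_itv /= => /andP[t0]; rewrite ger0_norm // le_eqVlt.
  by case/predU1P=> [->|/c_lt]; rewrite rmorph1 // => /ltW.
apply: bigcup_connected.
  by exists 0 => z _; exists 0; rewrite ?rmorph0 ?scale0r //= in_itv /= lexx ler01.
move=> z _; apply: connected_continuous_connected; first exact: segment_connected.
apply: continuous_subspaceT => t.
apply: (@cvg_comp _ _ _ c (fun k => k *: z) (nbhs t) (nbhs (c t))); first exact: cc.
exact: scalel_continuous.
Unshelve. all: by end_near. Qed.

(** Written entrywise so that the size of each coordinate can be read off. *)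
Definition polydisc (K : numFieldType) (n : nat) (e : K) : set 'rV[K]_n :=
  [set z | forall j, `|z 0 j| < e].

Lemma polydiscE (K : numFieldType) (n : nat) (e : K) : 0 < e ->
  polydisc e = ball (0 : 'rV[K]_n) e.
Proof.
move=> e0; apply/seteqP; split => z /=.
  by move=> ze; split => // i j; rewrite ord1 -ball_normE /= mxE sub0r normrN.
by move=> [_ zb] j; have := zb 0 j; rewrite -ball_normE /= mxE sub0r normrN.
Qed.

Lemma complex_gt0_real (R : realType) (d : R[i]) :
  0 < d -> exists2 r : R, 0 < r & r%:C <= d.
Proof.
case: d => d d'; rewrite ltcE /= => /andP[/eqP d'0 d0].
by exists d => //; rewrite lecE /= d'0 eqxx lexx.
Qed.

Lemma polydisc_domain (R : realType) (e : R) : 0 < e ->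
  is_domain (polydisc (e%:C : R[i]) : set 'rV[R[i]]_3).
Proof.
move=> e0; have e0' : 0 < e%:C by rewrite (ltcR 0 e).
rewrite polydiscE //; split.
- exists 0; exact: ballxx.
- exact: ball_open.
- apply: (@ball0_connected R _ (real_complex R)) => //.
  + by move=> t; rewrite normc_def /= expr0n /= addr0 sqrtr_sqr.
  + by move=> s t st; rewrite ltcR.
  + exact: complex_gt0_real.
Qed.

Lemma polydisc_ReIm (R : realType) (n : nat) (e : R) (z : 'rV[R[i]]_n) :
  polydisc (e%:C : R[i]) z -> forall j, `|complex.Re (z 0 j)| < e /\ `|complex.Im (z 0 j)| < e.
Proof.
move=> zb j; have := zb j; rewrite normc_def ltcR.
by case: (z 0 j) => a b /= ze; split; apply: le_lt_trans ze;
  rewrite -sqrtr_sqr ler_wsqrtr // ?lerDl ?lerDr sqr_ge0.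
Qed.

(** * Injectivity is an open condition *)

(** With a right inverse [P] of [M0], a row vector [v] killed by the perturbed matrix
satisfies [v = - v *m E *m P] for the perturbation [E]; if the entries of [E *m P] are
small the sum of the absolute values of the entries of [v] is less than itself,
unless [v = 0]. *)
Lemma row_free_near (R : realFieldType) (m n : nat) (I : finType)
    (M0 : 'M[R]_(m, n)) (M : I -> 'M[R]_(m, n)) : row_free M0 ->
  exists2 e : R, 0 < e & forall s : I -> R, (forall i, `|s i| < e) ->
    row_free (M0 + \sum_i s i *: M i).
Proof.
move=> /row_freeP[P M0P].
pose C : R := \sum_(k < m) \sum_(j < m) \sum_i `|(M i *m P) j k|.
have C0 : 0 <= C by do 3![apply: sumr_ge0 => ? _].
exists (1 + C)^-1 => [|s s_lt]; first by rewrite invr_gt0; lra.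
apply: inj_row_free => v /(congr1 (mulmx^~ P)).
rewrite mul0mx -mulmxA mulmxDl M0P mulmxDr mulmx1 => /eqP; rewrite addr_eq0 => /eqP v_eq.
pose S : R := \sum_k `|v 0 k|.
have vS j : `|v 0 j| <= S by rewrite /S (bigD1 j) //= lerDl sumr_ge0.
have S0 : 0 <= S by apply: sumr_ge0.
have SC : S <= (1 + C)^-1 * S * C.
  rewrite {1}/S /C mulr_sumr; apply: ler_sum => k _.
  rewrite {1}v_eq !mxE normrN mulr_sumr; apply: le_trans (ler_norm_sum _ _ _) _.
  apply: ler_sum => j _; rewrite normrM mulmx_suml summxE mulr_sumr.
  apply: le_trans (ler_wpM2l (normr_ge0 _) (ler_norm_sum _ _ _)) _.
  rewrite mulr_sumr; apply: ler_sum => i _.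
  rewrite -scalemxAl mxE normrM mulrCA mulrA.
  by rewrite ler_wpM2r // ler_pM // ltW.
have S_le0 : S <= 0.
  have C1 : 0 < 1 + C by lra.
  have SC' : (1 + C) * S <= S * C by rewrite -ler_pdivlMl // mulrA.
  lra.
apply/rowP => j; rewrite mxE; apply/eqP; rewrite -normr_le0.
exact: le_trans (vS j) _.
Qed.

Section InjectiveNear.
Import VectorInternalTheory.

Lemma inj_near (R : realFieldType) (g W : vectType R) (I : finType)
    (F0 : 'Hom(g, W)) (F : I -> 'Hom(g, W)) : (forall x, F0 x = 0 -> x = 0) ->
  exists2 e : R, 0 < e & forall s : I -> R, (forall i, `|s i| < e) ->
    forall x, F0 x + \sum_i s i *: F i x = 0 -> x = 0.
Proof.
have f2mxE (f : 'Hom(g, W)) x : v2r (f x) = v2r x *m f2mx f.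
  by rewrite unlock /= r2vK.
move=> F0_inj; have [|e e0 free_e] := @row_free_near R _ _ I (f2mx F0) (f2mx \o F).
  apply: inj_row_free => v; rewrite -[v]r2vK -f2mxE -(linear0 v2r).
  by move/(can_inj v2rK)/F0_inj => ->; rewrite linear0.
exists e => // s /free_e /row_free_inj inj_s x Fx0.
apply: (can_inj v2rK); apply: inj_s.
rewrite linear0 mul0mx mulmxDr -f2mxE mulmx_sumr -[RHS](linear0 v2r) -Fx0.
rewrite linearD linear_sum; congr (_ + _); apply: eq_bigr => i _.
by rewrite -scalemxAr -f2mxE linearZ.
Qed.

End InjectiveNear.

(** * Affine fields attached to a pair of cocycles *)

Lemma linear_hom (K : fieldType) (U V : vectType K) (f : U -> V) : linear f ->
  exists F : 'Hom(U, V), F =1 f.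
Proof.
move=> f_lin.
pose f' : {linear U -> V} := HB.pack f (GRing.isLinear.Build K U V *:%R f f_lin).
by exists (linfun f') => x; rewrite lfunE.
Qed.

(** The linear part is applied on the right of row vectors. The sign makes up for
the fact that the bracket of linear vector fields is opposite to the commutator
of their matrices. *)
Definition affine_field (K : numFieldType) (n : nat) (A : 'M[K]_n) (b : 'rV[K]_n) :=
  fun z : 'rV[K]_n => - (z *m A + b).

Lemma derive_affine_field (K : numFieldType) (n : nat) (A : 'M[K]_n) (b v z : 'rV[K]_n) :
  'D_v (affine_field A b) z = - (v *m A).
Proof.
rewrite /derive; apply: cvg_lim; first exact: norm_hausdorff.
(* For h != 0 the difference quotient does not depend on h. *)
apply: cvg_near_cst; near=> h.
have h0 : h != 0 by near: h; exact: nbhs_dnbhs_neq.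
rewrite /affine_field /= mulmxDl -scalemxAl -addrA opprK opprD addrNK.
by rewrite scalerN scalerA mulVf // scale1r.
Unshelve. all: by end_near. Qed.

Lemma field_bracket_affine (K : numFieldType) n (A B : 'M[K]_n) (a b z : 'rV[K]_n) :
  field_bracket (affine_field A a) (affine_field B b) z =
  affine_field (B *m A - A *m B) (b *m A - a *m B) z.
Proof.
rewrite /field_bracket !derive_affine_field /affine_field.
rewrite !mulNmx !opprK !mulmxDl mulmxBr !mulmxA !opprD !opprK addrACA.
by rewrite [- _ + z *m A *m B]addrC [- (b *m A) + _]addrC.
Qed.

Section CocycleField.
Variables (R : realType) (g : vectType R).
Variables (rho : {linear g -> 'M[R]_3}) (b1 b2 : {linear g -> 'rV[R]_3}).

(** The two real cocycles are the real and imaginary parts of a complex one. *)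
Definition cocycle_field (x : g) : 'rV[R[i]]_3 -> 'rV[R[i]]_3 :=
  affine_field (map_mx (real_complex R) (rho x))
    (\row_j (b1 x 0 j +i* b2 x 0 j)).

Lemma cocycle_field_linear (t : R) x y z :
  cocycle_field (t *: x + y) z = t%:C *: cocycle_field x z + cocycle_field y z.
Proof.
rewrite /cocycle_field /affine_field scalerN -opprD scalerDr addrACA; congr (- (_ + _)).
  by rewrite linearP map_mxD map_mxZ mulmxDr -scalemxAr.
apply/rowP => j; rewrite !mxE !linearP !mxE; apply/eqP.
by rewrite eq_complex /= !mul0r subr0 addr0 !eqxx.
Qed.

Lemma cocycle_field_bracket (br : g -> g -> g) x y z :
  rho (br x y) = rho y *m rho x - rho x *m rho y ->
  b1 (br x y) = b1 y *m rho x - b1 x *m rho y ->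
  b2 (br x y) = b2 y *m rho x - b2 x *m rho y ->
  cocycle_field (br x y) z = field_bracket (cocycle_field x) (cocycle_field y) z.
Proof.
move=> rhoE b1E b2E; rewrite field_bracket_affine /cocycle_field rhoE b1E b2E; congr affine_field.
  by rewrite map_mxB !map_mxM.
have cM (u v : 'rV[R]_3) (A : 'M[R]_3) :
    (\row_j (u 0 j +i* v 0 j)) *m map_mx (real_complex R) A =
    \row_j ((u *m A) 0 j +i* (v *m A) 0 j).
  apply/rowP => k; rewrite !mxE !big_ord_recl !big_ord0 !mxE.
  by apply/eqP; rewrite eq_complex /=; apply/andP; split; apply/eqP; ring.
by rewrite !cM; apply/rowP => k; rewrite !mxE.
Qed.

(** At a point [p + i q] the value at [x] of the field has real and imaginary parts
[b1 x + p *m rho x] and [b2 x + q *m rho x]: a perturbation of [(b1, b2)] which is linear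
in the six real coordinates of the point, to which [inj_near] applies. *)
Lemma cocycle_field_inj : (forall x, b1 x = 0 -> b2 x = 0 -> x = 0) ->
  exists2 e : R, 0 < e & forall z, polydisc (e%:C : R[i]) z ->
    forall x, cocycle_field x z = 0 -> x = 0.
Proof.
move=> b_inj.
have [F0 F0E] : exists F : 'Hom(g, ('rV[R]_3 * 'rV[R]_3)%type), F =1 (fun x => (b1 x, b2 x)).
  by apply: linear_hom => t x y; rewrite !linearP.
have /choice[F FE] : forall i : 'I_3 + 'I_3, exists F : 'Hom(g, ('rV[R]_3 * 'rV[R]_3)%type),
    F =1 (fun x => match i with inl j => (row j (rho x), 0) | inr j => (0, row j (rho x)) end).
  by case=> j; apply: linear_hom => t x y; rewrite !linearP; congr pair; rewrite /= scaler0 addr0.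
have [|e e0 inj_e] := @inj_near R g _ _ F0 F.
  by move=> x; rewrite F0E => -[]; exact: b_inj.
exists e => // z /polydisc_ReIm ze x phi0.
pose s (i : 'I_3 + 'I_3) : R := match i with inl j => complex.Re (z 0 j) | inr j => complex.Im (z 0 j) end.
apply: (inj_e s); first by case=> j; case: (ze j).
set T := _ + _; suff [T1 T2] : T.1 = 0 /\ T.2 = 0 by rewrite [T]surjective_pairing T1 T2.
have {}phi0 j : b1 x 0 j +i* b2 x 0 j + \sum_k z 0 k * (rho x k j)%:C = 0.
  move/eqP: phi0; rewrite oppr_eq0 => /eqP/rowP/(_ j); rewrite !mxE addrC.
  by under eq_bigr do rewrite !mxE.
rewrite /T F0E big_sumType /= !big_ord_recl !big_ord0 /= !FE /=.
split; apply/rowP => j; move: (phi0 j); rewrite !big_ord_recl big_ord0 !mxE;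
  move: (z 0 _) (z 0 _) (z 0 _) => [p0 q0] [p1 q1] [p2 q2] /eqP;
  by rewrite eq_complex /= => /andP[/eqP rE /eqP iE]; lra.
Qed.

End CocycleField.

Lemma affine_fields_of_cocycles (R : realType) (g : vectType R) (br : g -> g -> g)
    (rho : {linear g -> 'M[R]_3}) (b1 b2 : {linear g -> 'rV[R]_3}) :
  (forall x y, rho (br x y) = rho y *m rho x - rho x *m rho y) ->
  (forall x y, b1 (br x y) = b1 y *m rho x - b1 x *m rho y) ->
  (forall x y, b2 (br x y) = b2 y *m rho x - b2 x *m rho y) ->
  (forall x, b1 x = 0 -> b2 x = 0 -> x = 0) ->
  exists (D : set 'rV[R[i]]_3) (phi : g -> 'rV[R[i]]_3 -> 'rV[R[i]]_3),
    [/\ is_domain D,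
        affine_field_embedding br D phi &
        forall (n : nat) (e : n.-tuple g), free e ->
          forall z, D z -> real_independent (fun i => phi (tnth e i) z)].
Proof.
move=> rhoM b1M b2M b_inj; have [e e0 inj_e] := cocycle_field_inj rho b_inj.
set phi := cocycle_field rho b1 b2 in inj_e.
have phiP t x y z : phi (t *: x + y) z = t%:C *: phi x z + phi y z by apply: cocycle_field_linear.
exists (polydisc (e%:C : R[i])), phi; split.
- exact: polydisc_domain.
- split=> [x j|||x y xy].
  + exists (- (b1 x 0 j +i* b2 x 0 j)), (fun k => - (rho x k j)%:C) => z _.
    rewrite /phi /cocycle_field /affine_field !mxE opprD addrC -sumrN; congr (_ + _).
    by apply: eq_bigr => k _; rewrite !mxE mulNr mulrC.
  + by move=> t x y z _.
  + by move=> x y z _; apply: cocycle_field_bracket.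
  + apply/eqP; rewrite -subr_eq0; apply/eqP.
    have z0 : polydisc (e%:C : R[i]) (0 : 'rV[R[i]]_3).
      by move=> j; rewrite mxE normr0 (ltcR 0 e).
    apply: (inj_e _ z0); rewrite addrC -scaleN1r phiP -xy //.
    by rewrite rmorphN1 scaleN1r addNr.
- move=> n f free_f z Dz c sum0.
  have : \sum_i c i *: f`_i = 0.
    apply: (inj_e z) => //; rewrite -sum0.
    have phi0 : phi 0 z = 0.
      by have := phiP (-1) 0 0 z; rewrite scaler0 addr0 rmorphN1 scaleN1r addNr.
    elim/big_rec2 : _ => [|i y1 y2 _ <-]; first exact: phi0.
    by rewrite phiP (tnth_nth 0).
  by move: free_f => /freeP; apply.
Qed.

(** * The algebraic problem *)

(** A real representation [rho] of dimension 3, in matrices acting on the right of row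
vectors, and two cocycles whose kernels meet trivially. *)
Definition realizable (R : fieldType) (g : vectType R) (br : g -> g -> g) : Prop :=
  exists (rho : 'Hom(g, 'M[R]_3)) (b1 b2 : 'Hom(g, 'rV[R]_3)),
  [/\ forall x y, rho (br x y) = rho y *m rho x - rho x *m rho y,
      forall x y, b1 (br x y) = b1 y *m rho x - b1 x *m rho y,
      forall x y, b2 (br x y) = b2 y *m rho x - b2 x *m rho y &
      forall x, b1 x = 0 -> b2 x = 0 -> x = 0].

Section Functionals.
Variables (R : fieldType) (g : vectType R).

(** Typed in [R] rather than [R^o], so that values of functionals mix with scalars. *)
Definition ev (f : 'Hom(g, R^o)) (x : g) : R := f x.

Lemma evD f x y : ev f (x + y) = ev f x + ev f y. Proof. by rewrite /ev linearD. Qed.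
Lemma evN f x : ev f (- x) = - ev f x. Proof. by rewrite /ev linearN. Qed.
Lemma evZ f a x : ev f (a *: x) = a * ev f x. Proof. by rewrite /ev linearZ. Qed.
Lemma ev0 f : ev f 0 = 0. Proof. by rewrite /ev linear0. Qed.
Lemma evDf f f' x : ev (f + f') x = ev f x + ev f' x. Proof. by rewrite /ev add_lfunE. Qed.
Lemma evNf f x : ev (- f) x = - ev f x. Proof. by rewrite /ev opp_lfunE. Qed.
Lemma evZf f a x : ev (a *: f) x = a * ev f x. Proof. by rewrite /ev scale_lfunE. Qed.
Definition evE := (evD, evN, evZ, ev0, evDf, evNf, evZf).

Lemma functional (f : g -> R) : (forall a x y, f (a *: x + y) = a * f x + f y) ->
  exists F : 'Hom(g, R^o), ev F =1 f.
Proof. by move=> /(@linear_hom R g R^o f). Qed.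

Lemma ev_inj x y : (forall f, ev f x = ev f y) -> x = y.
Proof.
move=> xy; rewrite (coord_vbasis (memvf x)) (coord_vbasis (memvf y)).
apply: eq_bigr => i _; congr (_ *: _).
have [F FE] := @functional (coord (vbasis fullv) i) (linearP _).
by rewrite -!FE.
Qed.

Lemma ev_neq0 (chi : 'Hom(g, R^o)) e : ev chi e != 0 -> chi != 0.
Proof. by apply: contra => /eqP ->; rewrite /ev lfunE. Qed.

(** A basis together with its dual basis. *)
Record frame (e0 e1 e2 e3 : g) (c0 c1 c2 c3 : 'Hom(g, R^o)) : Prop := Frame {
  frameE : forall x,
    x = ev c0 x *: e0 + ev c1 x *: e1 + ev c2 x *: e2 + ev c3 x *: e3;
  frame0 : [/\ ev c0 e0 = 1, ev c0 e1 = 0, ev c0 e2 = 0 & ev c0 e3 = 0];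
  frame1 : [/\ ev c1 e0 = 0, ev c1 e1 = 1, ev c1 e2 = 0 & ev c1 e3 = 0];
  frame2 : [/\ ev c2 e0 = 0, ev c2 e1 = 0, ev c2 e2 = 1 & ev c2 e3 = 0];
  frame3 : [/\ ev c3 e0 = 0, ev c3 e1 = 0, ev c3 e2 = 0 & ev c3 e3 = 1] }.

Lemma frame_of_basis (e0 e1 e2 e3 : g) : \dim {:g} = 4%N ->
  (forall t0 t1 t2 t3, t0 *: e0 + t1 *: e1 + t2 *: e2 + t3 *: e3 = 0 ->
    [/\ t0 = 0, t1 = 0, t2 = 0 & t3 = 0]) ->
  exists c0 c1 c2 c3, frame e0 e1 e2 e3 c0 c1 c2 c3.
Proof.
move=> dim4 indep; pose X := [tuple e0; e1; e2; e3].
have freeX : free X.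
  apply/freeP => k; rewrite !big_ord_recl big_ord0 /= addr0 !addrA => /indep[k0 k1 k2 k3] i.
  by case: i => [[|[|[|[|//]]]] i4];
    [rewrite -[RHS]k0|rewrite -[RHS]k1|rewrite -[RHS]k2|rewrite -[RHS]k3];
    congr k; apply: val_inj.
have basisX : basis_of fullv X by rewrite basisEfree freeX subvf size_tuple dim4.
have [c0 c0E] := @functional (coord X (@Ordinal 4 0 isT)) (linearP _).
have [c1 c1E] := @functional (coord X (@Ordinal 4 1 isT)) (linearP _).
have [c2 c2E] := @functional (coord X (@Ordinal 4 2 isT)) (linearP _).
have [c3 c3E] := @functional (coord X (@Ordinal 4 3 isT)) (linearP _).
have XE (j : 'I_4) : [/\ coord X j e0 = (0 == j :> nat)%:R,
    coord X j e1 = (1 == j :> nat)%:R, coord X j e2 = (2 == j :> nat)%:R &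
    coord X j e3 = (3 == j :> nat)%:R].
  have XE (k : 'I_4) : coord X j X`_k = (k == j :> nat)%:R by rewrite coord_free.
  by split; [exact: (XE (@Ordinal 4 0 isT))|exact: (XE (@Ordinal 4 1 isT))|
    exact: (XE (@Ordinal 4 2 isT))|exact: (XE (@Ordinal 4 3 isT))].
exists c0, c1, c2, c3; split.
- move=> x; rewrite [LHS](coord_basis basisX (memvf x)) c0E c1E c2E c3E.
  rewrite !big_ord_recl big_ord0 addr0 /= !addrA.
  by do !congr (_ + _); congr (coord _ _ _ *: _); apply: val_inj.
- by rewrite !c0E; exact: (XE (@Ordinal 4 0 isT)).
- by rewrite !c1E; exact: (XE (@Ordinal 4 1 isT)).
- by rewrite !c2E; exact: (XE (@Ordinal 4 2 isT)).
- by rewrite !c3E; exact: (XE (@Ordinal 4 3 isT)).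
Qed.

Lemma frame_inj e0 e1 e2 e3 c0 c1 c2 c3 x y : frame e0 e1 e2 e3 c0 c1 c2 c3 ->
  ev c0 x = ev c0 y -> ev c1 x = ev c1 y -> ev c2 x = ev c2 y ->
  ev c3 x = ev c3 y -> x = y.
Proof.
move=> fr h0 h1 h2 h3.
by rewrite [LHS](frameE fr) [RHS](frameE fr) h0 h1 h2 h3.
Qed.

Lemma frame_swap (e0 e1 e2 e3 : g) c0 c1 c2 c3 :
  frame e0 e1 e2 e3 c0 c1 c2 c3 -> frame e0 e1 e3 e2 c0 c1 c3 c2.
Proof.
move=> [frE [a0 a1 a2 a3] [b0 b1 b2 b3] [c20 c21 c22 c23] [d0 d1 d2 d3]]; split=> //.
by move=> x; rewrite addrAC -frE.
Qed.

Lemma alternating_frame0 (V : lmodType R) (F : g -> g -> V) e0 e1 e2 e3 c0 c1 c2 c3 :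
  frame e0 e1 e2 e3 c0 c1 c2 c3 ->
  (forall x, linear (F x)) -> (forall x, F x x = 0) -> (forall x y, F x y = - F y x) ->
  F e0 e1 = 0 -> F e0 e2 = 0 -> F e0 e3 = 0 -> F e1 e2 = 0 -> F e1 e3 = 0 ->
  F e2 e3 = 0 -> forall x y, F x y = 0.
Proof.
move=> fr Fl Fxx FC F01 F02 F03 F12 F13 F23.
have F0 x : F x 0 = 0.
  by have := Fl x (-1) 0 0; rewrite scaler0 addr0 scaleN1r addNr.
have FE x y : F x e0 = 0 -> F x e1 = 0 -> F x e2 = 0 -> F x e3 = 0 -> F x y = 0.
  move=> x0 x1 x2 x3; rewrite (frameE fr y) -!addrA.
  by rewrite Fl x0 scaler0 add0r Fl x1 scaler0 add0r Fl x2 scaler0 add0r -[_ *: e3]addr0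
    Fl x3 F0 scaler0 addr0.
by move=> x y; rewrite FE //; rewrite FC FE ?oppr0 // FC ?F01 ?F02 ?F03 ?F12 ?F13 ?F23 oppr0.
Qed.

Lemma dim_lker (chi : 'Hom(g, R^o)) : \dim {:g} = 4%N -> chi != 0 ->
  \dim (lker chi) = 3%N.
Proof.
move=> dim4 chi0; have := limg_ker_dim chi fullv; rewrite capfv dim4.
suff -> : \dim (limg chi) = 1%N by rewrite addn1 => -[].
apply/eqP; rewrite eqn_leq; apply/andP; split.
  by have := dimvS (subvf (limg chi)); rewrite dimvf.
rewrite lt0n dimv_eq0; apply: contra chi0 => /eqP im0.
apply/eqP/lfunP => x; rewrite lfunE; apply/eqP; rewrite -memv0 -im0.
exact: memv_img (memvf x).
Qed.

(** Completes two independent functionals to a dual basis. *)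
Lemma adapted_frame (c0 c1 : 'Hom(g, R^o)) e y :
  \dim {:g} = 4%N -> ev c0 e != 0 -> ev c0 y = 0 -> ev c1 y != 0 ->
  exists e0 e1 f1 f2 c2 c3, frame e0 e1 f1 f2 c0 c1 c2 c3.
Proof.
move=> dim4 c0e c0y c1y; pose K := (lker c0 :&: lker c1)%VS.
have dimK : (2 <= \dim K)%N.
  have := dimv_sum_cap (lker c0) (lker c1).
  rewrite (dim_lker dim4 (ev_neq0 c0e)) (dim_lker dim4 (ev_neq0 c1y)).
  by have := dimvS (subvf (lker c0 + lker c1)%VS); rewrite dim4 -/K; lia.
have [f1 [f2 [f1K f2K f_free]]] : exists f1 f2, [/\ f1 \in K, f2 \in K & free [:: f1; f2]].
  have := vbasisP K; case/andP => /eqP spanX freeX.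
  have memX x : x \in (vbasis K : seq g) -> x \in K by exact: vbasis_mem.
  move: freeX memX (size_tuple (vbasis K)); case: (tval (vbasis K)) => [|f1 [|f2 s]] //=;
    [by lia|by lia|move=> freeX memX _].
  exists f1, f2; rewrite !memX ?inE ?eqxx ?orbT //; split=> //.
  by move: freeX; rewrite -[f1 :: f2 :: s]/([:: f1; f2] ++ s) => /catl_free.
have inK f : f \in K -> ev c0 f = 0 /\ ev c1 f = 0.
  by rewrite memv_cap !memv_ker => /andP[/eqP ? /eqP ?].
have [[f10 f11] [f20 f21]] := (inK f1 f1K, inK f2 f2K).
have [e1 e1E] : exists e1, e1 = (ev c1 y)^-1 *: y by eexists.
have [e0 e0E] : exists e0, e0 = (ev c0 e)^-1 *: e - (ev c1 e / ev c0 e) *: e1 by eexists.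
have [e10 e11] : ev c0 e1 = 0 /\ ev c1 e1 = 1.
  by rewrite e1E !evE c0y; split; [ring|field].
have [e00 e01] : ev c0 e0 = 1 /\ ev c1 e0 = 0.
  by rewrite e0E !evE e10 e11; split; field.
have [|d0 [d1 [d2 [d3 fr]]]] := @frame_of_basis e0 e1 f1 f2 dim4.
  move=> t0 t1 t2 t3 sum0.
  have t0_0 : t0 = 0.
    by have := congr1 (ev c0) sum0; rewrite !(evD, evZ, ev0) e00 e10 f10 f20 => <-; ring.
  have t1_0 : t1 = 0.
    by have := congr1 (ev c1) sum0; rewrite !(evD, evZ, ev0) e01 e11 f11 f21 => <-; ring.
  move: sum0; rewrite t0_0 t1_0 !scale0r !add0r => sum0.
  have /freeP /(_ (fun i : 'I_2 => [:: t2; t3]`_i)) := f_free.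
  rewrite !big_ord_recl big_ord0 /= addr0 => /(_ sum0) k0.
  by split=> //; [exact: (k0 (@Ordinal 2 0 isT))|exact: (k0 (@Ordinal 2 1 isT))].
have c0E : c0 = d0.
  apply/lfunP => x; rewrite -[LHS]/(ev c0 x) {1}(frameE fr x) !(evD, evZ).
  by rewrite e00 e10 f10 f20 -[RHS]/(ev d0 x); ring.
have c1E : c1 = d1.
  apply/lfunP => x; rewrite -[LHS]/(ev c1 x) {1}(frameE fr x) !(evD, evZ).
  by rewrite e01 e11 f11 f21 -[RHS]/(ev d1 x); ring.
by exists e0, e1, f1, f2, d2, d3; rewrite c0E c1E.
Qed.

Lemma exists_frame : \dim {:g} = 4%N ->
  exists (e0 e1 e2 e3 : g) c0 c1 c2 c3, frame e0 e1 e2 e3 c0 c1 c2 c3.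
Proof.
move=> dim4; have := vbasisP {:g}; move: (vbasis _); rewrite dim4 => X /andP[_ /freeP X_free].
have [|c0 [c1 [c2 [c3 fr]]]] := @frame_of_basis X`_0 X`_1 X`_2 X`_3 dim4; last first.
  by exists X`_0, X`_1, X`_2, X`_3, c0, c1, c2, c3.
move=> t0 t1 t2 t3 sum0.
have /= := X_free (fun i => [:: t0; t1; t2; t3]`_i).
rewrite !big_ord_recl big_ord0 /= addr0 !addrA => /(_ sum0) t_0.
by split; [exact: (t_0 (@Ordinal 4 0 isT))|exact: (t_0 (@Ordinal 4 1 isT))|
  exact: (t_0 (@Ordinal 4 2 isT))|exact: (t_0 (@Ordinal 4 3 isT))].
Qed.

End Functionals.

(** Equalities of vectors are checked on functionals, where they become ring
identities. *)
Ltac vector_ring := apply: ev_inj => ?; rewrite !evE; ring.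

Section Bracket.
Variables (R : fieldType) (g : vectType R) (br : g -> g -> g).
Hypothesis hbr : is_lie_bracket br.
Local Notation "[ x , y ]" := (br x y).

Lemma br_lin x : linear (br x).
Proof. by case: hbr => -[_ brP] _ _; exact: brP. Qed.
Lemma br_linl y : linear (br^~ y).
Proof. by case: hbr => -[brP _] _ _; exact: brP. Qed.
Lemma brxx x : br x x = 0. Proof. by case: hbr. Qed.
Lemma brDl x y z : br (x + y) z = br x z + br y z.
Proof. by have := br_linl z 1 x y; rewrite !scale1r. Qed.
Lemma brDr x y z : br z (x + y) = br z x + br z y.
Proof. by have := br_lin z 1 x y; rewrite !scale1r. Qed.
Lemma br0l z : br 0 z = 0.
Proof. by have /eqP := brDl 0 0 z; rewrite addr0 -subr_eq0 opprD addNKr oppr_eq0 => /eqP. Qed.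
Lemma br0r z : br z 0 = 0.
Proof. by have /eqP := brDr 0 0 z; rewrite addr0 -subr_eq0 opprD addNKr oppr_eq0 => /eqP. Qed.
Lemma brZl a x z : br (a *: x) z = a *: br x z.
Proof. by have := br_linl z a x 0; rewrite !addr0 br0l addr0. Qed.
Lemma brZr a x z : br z (a *: x) = a *: br z x.
Proof. by have := br_lin z a x 0; rewrite !addr0 br0r addr0. Qed.
Lemma brNl x z : br (- x) z = - br x z.
Proof. by rewrite -scaleN1r brZl scaleN1r. Qed.
Lemma brNr x z : br z (- x) = - br z x.
Proof. by rewrite -scaleN1r brZr scaleN1r. Qed.
Definition brE := (brDl, brDr, brZl, brZr, brNl, brNr, br0l, br0r, brxx).

Lemma brC x y : br x y = - br y x.
Proof.
have := brxx (x + y); rewrite !brE add0r addr0 => /eqP.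
by rewrite addr_eq0 => /eqP.
Qed.

Lemma jacobi x y z : br x (br y z) = br (br x y) z + br y (br x z).
Proof.
have [_ _ /(_ x y z)] := hbr.
rewrite (brC z (br x y)) (brC z x) brNr => /eqP.
by rewrite -addrA addr_eq0 opprD !opprK addrC => /eqP.
Qed.

(** The form in which [realizable] is proved: the representation space is the
hyperplane [chi = 0] of g itself, with an action [act] that may differ from the
adjoint one. *)
Lemma realizable_on_hyperplane (chi : 'Hom(g, R^o)) (act : g -> g -> g) (b1 b2 : g -> g) :
  \dim {:g} = 4%N -> chi != 0 ->
  (forall x, linear (act x)) -> (forall y, linear (act^~ y)) -> linear b1 -> linear b2 ->
  (forall x w, ev chi w = 0 -> ev chi (act x w) = 0) ->
  (forall x, ev chi (b1 x) = 0) -> (forall x, ev chi (b2 x) = 0) ->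
  (forall x y w, ev chi w = 0 -> act [x, y] w = act x (act y w) - act y (act x w)) ->
  (forall x y, b1 [x, y] = act x (b1 y) - act y (b1 x)) ->
  (forall x y, b2 [x, y] = act x (b2 y) - act y (b2 x)) ->
  (forall x, b1 x = 0 -> b2 x = 0 -> x = 0) ->
  realizable br.
Proof.
move=> dim4 chi0 actr actl b1l b2l chi_act chi_b1 chi_b2 actM b1M b2M b_inj.
have dimh := dim_lker dim4 chi0.
have [X basisX] : exists X : 3.-tuple g, basis_of (lker chi) X.
  by rewrite -dimh; exists (vbasis (lker chi)); exact: vbasisP.
have inh x : ev chi x = 0 -> x \in lker chi by move=> x0; rewrite memv_ker -[chi x]/(ev chi x) x0.
pose C w : 'rV[R]_3 := \row_j coord X j w.
have Cl : linear C by move=> t x y; apply/rowP => j; rewrite !mxE linearP.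
have C0 w : ev chi w = 0 -> C w = 0 -> w = 0.
  move=> /inh w_h /rowP Cw; rewrite (coord_basis basisX w_h) big1 // => i _.
  by have := Cw i; rewrite !mxE => ->; rewrite scale0r.
have [rho rhoE] : exists rho : 'Hom(g, 'M[R]_3),
    rho =1 (fun x => \matrix_i C (act x X`_i)).
  apply: linear_hom => t x y; apply/row_matrixP => i.
  by rewrite linearP /= !rowK actl Cl.
have rho_C x w : ev chi w = 0 -> C w *m rho x = C (act x w).
  pose Cf : {linear g -> 'rV[R]_3} := HB.pack C (GRing.isLinear.Build R g _ *:%R C Cl).
  pose af : {linear g -> g} := HB.pack (act x) (GRing.isLinear.Build R g g *:%R (act x) (actr x)).
  move=> /inh w_h; rewrite {2}(coord_basis basisX w_h).
  rewrite -[C (act x _)]/(Cf (af _)) !linear_sum mulmx_sum_row; apply: eq_bigr => i _.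
  by rewrite !linearZ rhoE rowK mxE.
have Cb b : linear b -> exists B : 'Hom(g, 'rV[R]_3), B =1 C \o b.
  by move=> bl; apply: linear_hom => t x y; rewrite /= bl Cl.
have [[B1 B1E] [B2 B2E]] := (Cb _ b1l, Cb _ b2l).
have CB x y : C (x - y) = C x - C y.
  by rewrite addrC -scaleN1r Cl scaleN1r addrC.
have X_h (i : 'I_3) : ev chi X`_i = 0.
  have : X`_i \in lker chi by rewrite (basis_mem basisX) // mem_nth // size_tuple.
  by rewrite memv_ker => /eqP.
exists rho, B1, B2; split=> [x y|x y|x y|x].
- apply/row_matrixP => i; rewrite raddfB /= !row_mul !rhoE !rowK -!rhoE !rho_C ?chi_act ?X_h //.
  by rewrite actM ?CB //; exact: X_h.
- by rewrite !B1E /= !rho_C // b1M CB.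
- by rewrite !B2E /= !rho_C // b2M CB.
- by rewrite B1E B2E => /(C0 _ (chi_b1 x)) b1x /(C0 _ (chi_b2 x)) b2x; exact: b_inj.
Qed.

End Bracket.

Section Realizations.
Variables (R : realFieldType) (g : vectType R) (br : g -> g -> g).
Hypothesis hbr : is_lie_bracket br.
Hypothesis dim4 : \dim {:g} = 4%N.
Local Notation "[ x , y ]" := (br x y).
Local Notation brE := (brE hbr).

(** * Realization by derivations *)

(** The multiple [chi x *: v] is a cocycle for the adjoint action on [ker chi]: the
cocycle identity says that [v] commutes with [chi y *: x - chi x *: y], which lies in
[ker chi]. *)
Lemma realizable_of_derivation (chi : 'Hom(g, R^o)) e (D : g -> g) v :
  ev chi e != 0 -> (forall x y, ev chi [x, y] = 0) ->
  linear D -> (forall x, ev chi (D x) = 0) ->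
  (forall x y, D [x, y] = [x, D y] - [y, D x]) ->
  (forall x, ev chi x = 0 -> D x = 0 -> x = 0) ->
  v != 0 -> ev chi v = 0 -> (forall y, ev chi y = 0 -> [y, v] = 0) ->
  realizable br.
Proof.
move=> /ev_neq0 chi0 chi_br Dl chiD Dder D_inj v0 chiv vC.
apply: (realizable_on_hyperplane (chi := chi) (act := br) (b1 := D)
  (b2 := fun x => ev chi x *: v)) => //.
- exact: br_lin.
- exact: br_linl.
- by move=> t x y; vector_ring.
- by move=> x; rewrite evE chiv mulr0.
- by move=> x y w _; rewrite (jacobi hbr x y w) addrK.
- move=> x y; rewrite chi_br scale0r.
  have : [ev chi y *: x - ev chi x *: y, v] = 0 by apply: vC; rewrite !evE; ring.
  by rewrite !brE => <-.
- move=> x Dx /eqP; rewrite scaler_eq0 (negPf v0) orbF => /eqP chix; exact: D_inj.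
Qed.

(** The projection onto [ker chi] along [e] is a derivation when [ker chi] is abelian. *)
Lemma realizable_of_abelian (chi : 'Hom(g, R^o)) e v :
  ev chi e != 0 -> (forall x y, ev chi [x, y] = 0) ->
  (forall x y, ev chi x = 0 -> ev chi y = 0 -> [x, y] = 0) ->
  v != 0 -> ev chi v = 0 -> realizable br.
Proof.
move=> chie chi_br ab v0 chiv; pose t x := ev chi x / ev chi e.
have chit x : ev chi (x - t x *: e) = 0 by rewrite /t !evE; field.
apply: (@realizable_of_derivation chi e (fun x => x - t x *: e) v) => //.
- by move=> a x y; apply: ev_inj => f; rewrite /t !evE; ring.
- move=> x y; rewrite {1}/t chi_br mul0r scale0r subr0.
  have := ab _ _ (chit x) (chit y); rewrite !brE => xy0.
  rewrite (brC hbr y x) (brC hbr y e) -[LHS]addr0 -xy0; vector_ring.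
- by move=> x chix; rewrite /t chix mul0r scale0r subr0.
- by move=> y chiy; apply: ab.
Qed.

(** The Heisenberg algebra [h] has the derivation with weights 1, 1, 2. It extends to
g once the image [w] of [e0] is chosen so that [ad w] corrects the components on the
centre of [[e0, e1]] and [[e0, e2]]; these have weight 2 and not 1. *)
Lemma realizable_of_heisenberg e0 e1 e2 e3 c0 c1 c2 c3 :
  frame e0 e1 e2 e3 c0 c1 c2 c3 -> (forall x y, ev c0 [x, y] = 0) ->
  [e1, e2] = e3 -> [e1, e3] = 0 -> [e2, e3] = 0 -> realizable br.
Proof.
move=> fr c0br e12 e13 e23.
have [[c00 c01 c02 c03] [c10 c11 c12 c13]] := (frame0 fr, frame1 fr).
have [[c20 c21 c22 c23] [c30 c31 c32 c33]] := (frame2 fr, frame3 fr).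
have cE := (c00, c01, c02, c03, c10, c11, c12, c13, c20, c21, c22, c23, c30, c31, c32, c33).
pose p := ev c3 [e0, e1]; pose r := ev c3 [e0, e2].
pose w := r *: e1 - p *: e2.
pose D x := ev c1 x *: e1 + ev c2 x *: e2 + (2 * ev c3 x) *: e3 + ev c0 x *: w.
have e3_0 : e3 != 0.
  by apply/eqP => e3_0; move: c33; rewrite e3_0 evE; apply/eqP; rewrite eq_sym oner_eq0.
have hE x : ev c0 x = 0 -> x = ev c1 x *: e1 + ev c2 x *: e2 + ev c3 x *: e3.
  by move=> x0; rewrite {1}(frameE fr x) x0 scale0r add0r.
have e21 : [e2, e1] = - e3 by rewrite (brC hbr) e12.
have e31 : [e3, e1] = 0 by rewrite (brC hbr) e13 oppr0.
have e32 : [e3, e2] = 0 by rewrite (brC hbr) e23 oppr0.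
have e03 : [e0, e3] = (ev c1 [e0, e1] + ev c2 [e0, e2]) *: e3.
  rewrite -{1}e12 (jacobi hbr) (hE [e0, e1]) // (hE [e0, e2]) // !brE.
  by rewrite e12 e13 e32 !evE !cE; vector_ring.
have Dl : linear D by move=> t x y; rewrite /D; vector_ring.
apply: (realizable_of_derivation (chi := c0) (e := e0) (D := D) (v := e3)) => //.
- by rewrite c00 oner_eq0.
- by move=> x; rewrite /D /w !evE !cE; ring.
- move=> x y; apply/eqP; rewrite -subr_eq0; apply/eqP; move: x y.
  have De0 : D e0 = w by rewrite /D !cE; vector_ring.
  have De1 : D e1 = e1 by rewrite /D !cE; vector_ring.
  have De2 : D e2 = e2 by rewrite /D !cE; vector_ring.
  have De3 : D e3 = 2 *: e3 by rewrite /D !cE; vector_ring.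
  have D0 : D 0 = 0 by rewrite /D !evE; vector_ring.
  have DN x : D (- x) = - D x.
    by rewrite -[- x]addr0 -scaleN1r Dl D0 addr0 scaleN1r.
  apply: (alternating_frame0 (F := fun x y => D [x, y] - ([x, D y] - [y, D x])) fr).
  + by move=> x t y z; rewrite /= Dl !brE Dl; vector_ring.
  + by move=> x; rewrite /= (brxx hbr) D0 !subrr.
  + by move=> x y; rewrite /= (brC hbr y x) DN; vector_ring.
  + rewrite De0 De1 (hE [e0, e1]) // /w !brE e12 /D !evE !cE -/p; vector_ring.
  + rewrite De0 De2 (hE [e0, e2]) // /w !brE e21 /D !evE !cE -/r; vector_ring.
  + rewrite De0 De3 /w !brE e03 e31 e32 /D !evE !cE; vector_ring.
  + rewrite De1 De2 e12 e21 De3; vector_ring.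
  + rewrite De1 De3 !brE e13 e31 D0; vector_ring.
  + rewrite De2 De3 !brE e23 e32 D0; vector_ring.
- move=> x x0 Dx; apply: (frame_inj fr); rewrite ?evE ?x0 //.
  + by have := congr1 (ev c1) Dx; rewrite /D x0 !evE !cE => <-; ring.
  + by have := congr1 (ev c2) Dx; rewrite /D x0 !evE !cE => <-; ring.
  + by have := congr1 (ev c3) Dx; rewrite /D x0 !evE !cE; lra.
- by move=> y y0; rewrite (hE y) // !brE e13 e23; vector_ring.
Qed.

(** * Algebras whose commutators lie in an abelian plane *)

(** With [k = ker chi0 :&: ker chi1], the map [ad u] takes its values in [k] and is the
identity there: it is at once a derivation and a projection onto [k]. The
representation space is [k] plus the line of [u], on which x acts through
[ad x \o ad u]; it is the direct sum of [k] and a trivial line, and the two functionals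
[chi0] and [chi1], which kill brackets, give cocycles in that line. *)
Lemma realizable_of_grading (chi0 chi1 : 'Hom(g, R^o)) e0 e1 u :
  ev chi0 e0 = 1 -> ev chi0 e1 = 0 -> ev chi1 e0 = 0 -> ev chi1 e1 = 1 ->
  (forall x y, ev chi0 [x, y] = 0) -> (forall x y, ev chi1 [x, y] = 0) ->
  (forall x, ev chi0 x = 0 -> ev chi1 x = 0 -> [u, x] = x) ->
  u != 0 -> realizable br.
Proof.
move=> c00 c01 c10 c11 chi0_br chi1_br u_id u0.
have u_out : (ev chi0 u != 0) || (ev chi1 u != 0).
  rewrite -negb_and; apply: contra u0 => /andP[/eqP u_0 /eqP u_1].
  by rewrite -(u_id u) // brE.
have uid_br x y : [u, [x, y]] = [x, y] by apply: u_id.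
pose psi := ev chi1 u *: chi0 - ev chi0 u *: chi1.
have psi_br x y : ev psi [x, y] = 0 by rewrite !evE chi0_br chi1_br; ring.
have psi_u : ev psi u = 0 by rewrite !evE; ring.
apply: (realizable_on_hyperplane (chi := psi) (act := fun x w => [x, [u, w]])
  (b1 := fun x => [u, x] + ev chi0 x *: u) (b2 := fun x => ev chi1 x *: u)) => //.
- case/orP: u_out => ?; [apply: (@ev_neq0 _ _ _ e1)|apply: (@ev_neq0 _ _ _ e0)];
    by rewrite !evE ?c00 ?c01 ?c10 ?c11 ?mulr0 ?mulr1 ?sub0r ?subr0 ?oppr_eq0.
- by move=> x a y z; rewrite !brE.
- by move=> x a y z; rewrite !brE.
- by move=> a x y; rewrite !brE; vector_ring.
- by move=> a x y; vector_ring.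
- by move=> x; rewrite evD evZ psi_br psi_u mulr0 addr0.
- by move=> x; rewrite evZ psi_u mulr0.
- by move=> x y w _; rewrite !uid_br (jacobi hbr x y) addrK.
- move=> x y; rewrite chi0_br scale0r addr0 !brE !scaler0 !addr0 !uid_br.
  by rewrite -{1}(uid_br x y) (jacobi hbr u x y) (brC hbr y) opprK addrC.
- by move=> x y; rewrite chi1_br scale0r !brE !scaler0 subr0.
- move=> x ux /eqP; rewrite scaler_eq0 (negPf u0) orbF => /eqP x1.
  have ux0 : [u, x] = 0.
    by have := congr1 (br u) ux; rewrite !brE uid_br scaler0 addr0.
  move: ux; rewrite ux0 add0r => /eqP; rewrite scaler_eq0 (negPf u0) orbF => /eqP x0.
  by rewrite -(u_id x).
Qed.

Lemma parallel_relation (F : fieldType) (a1 a2 a3 b1 b2 b3 : F) :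
  a1 * b2 = a2 * b1 -> a1 * b3 = a3 * b1 -> a2 * b3 = a3 * b2 ->
  exists s t, [/\ (s != 0) || (t != 0), s * a1 + t * b1 = 0, s * a2 + t * b2 = 0 &
    s * a3 + t * b3 = 0].
Proof.
move=> e12 e13 e23.
have [a1_0|a1_0] := eqVneq a1 0; last first.
  by exists b1, (- a1); rewrite oppr_eq0 a1_0 orbT !mulNr e12 e13; split=> //; ring.
have [a2_0|a2_0] := eqVneq a2 0; last first.
  by exists b2, (- a2); rewrite oppr_eq0 a2_0 orbT !mulNr e23 -e12; split=> //; ring.
have [a3_0|a3_0] := eqVneq a3 0; last first.
  by exists b3, (- a3); rewrite oppr_eq0 a3_0 orbT !mulNr -e13 -e23; split=> //; ring.
by exists 1, 0; rewrite oner_neq0; split=> //; rewrite ?a1_0 ?a2_0 ?a3_0; ring.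
Qed.

(** The elements [e0] and [e1] act on the plane spanned by [f1] and [f2] by commuting
matrices [a] and [b]. Modulo scalar matrices, two commuting 2 x 2 matrices are
linearly dependent, so a combination [w] of [e0] and [e1] acts as a scalar [q]. If [q = 0],
[w] and the plane span an abelian ideal. *)
Lemma realizable_of_abelian_plane e0 e1 f1 f2 c0 c1 c2 c3 :
  frame e0 e1 f1 f2 c0 c1 c2 c3 ->
  (forall x y, ev c0 [x, y] = 0) -> (forall x y, ev c1 [x, y] = 0) ->
  [f1, f2] = 0 -> realizable br.
Proof.
move=> fr c0br c1br f12.
have [[c00 c01 c02 c03] [c10 c11 c12 c13]] := (frame0 fr, frame1 fr).
have [[c20 c21 c22 c23] [c30 c31 c32 c33]] := (frame2 fr, frame3 fr).
have kE x : ev c0 x = 0 -> ev c1 x = 0 -> x = ev c2 x *: f1 + ev c3 x *: f2.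
  by move=> x0 x1; rewrite {1}(frameE fr x) x0 x1 !scale0r !add0r.
have brk x y : [x, y] = ev c2 [x, y] *: f1 + ev c3 [x, y] *: f2 by apply: kE.
have ab x y : ev c0 x = 0 -> ev c1 x = 0 -> ev c0 y = 0 -> ev c1 y = 0 -> [x, y] = 0.
  move=> x0 x1 y0 y1; rewrite (kE x) // (kE y) // !brE (brC hbr f2) f12.
  vector_ring.
set a1 := ev c2 [e0, f1]; set a2 := ev c3 [e0, f1].
set a3 := ev c2 [e0, f2]; set a4 := ev c3 [e0, f2].
set b1 := ev c2 [e1, f1]; set b2 := ev c3 [e1, f1].
set b3 := ev c2 [e1, f2]; set b4 := ev c3 [e1, f2].
have [e01 e02] : [e0, f1] = a1 *: f1 + a2 *: f2 /\ [e0, f2] = a3 *: f1 + a4 *: f2.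
  by split; apply: brk.
have [e11 e12] : [e1, f1] = b1 *: f1 + b2 *: f2 /\ [e1, f2] = b3 *: f1 + b4 *: f2.
  by split; apply: brk.
have com f : ev c0 f = 0 -> ev c1 f = 0 -> [e0, [e1, f]] = [e1, [e0, f]].
  by move=> f0 f1'; rewrite (jacobi hbr) (ab [e0, e1]) // add0r.
have [p1 p2] : a2 * b3 = a3 * b2 /\ (a1 - a4) * b2 = a2 * (b1 - b4).
  have := com f1 c02 c12; rewrite e11 e01 !brE e01 e02 e11 e12 => E.
  have := congr1 (ev c2) E; have := congr1 (ev c3) E; rewrite !evE c22 c23 c32 c33.
  by move=> E3 E2; split; lra.
have p3 : (a1 - a4) * b3 = a3 * (b1 - b4).
  have := com f2 c03 c13; rewrite e12 e02 !brE e01 e02 e11 e12 => E.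
  by have := congr1 (ev c2) E; rewrite !evE c22 c23 => E2; lra.
have [s [t [st0 r1 r2 r3]]] := parallel_relation p2 p3 p1.
have [w wE] : exists w, w = s *: e0 + t *: e1 by eexists.
have [q qE] : exists q, q = s * a1 + t * b1 by eexists.
have w1 : [w, f1] = q *: f1.
  by rewrite wE !brE e01 e11 -[RHS]addr0 -[0](scale0r f2) -r2 qE; vector_ring.
have w2 : [w, f2] = q *: f2.
  rewrite wE !brE e02 e12 -[RHS]addr0 -[0](scale0r f1) -r3 qE.
  have -> : s * a1 + t * b1 = s * a4 + t * b4 by lra.
  by vector_ring.
have wq x : ev c0 x = 0 -> ev c1 x = 0 -> [w, x] = q *: x.
  by move=> x0 x1; rewrite (kE x) // !brE w1 w2; vector_ring.
have f1_0 : f1 != 0.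
  by apply/eqP => f1_0; move: c22; rewrite f1_0 evE; apply/eqP; rewrite eq_sym oner_eq0.
have [q0|q0] := eqVneq q 0; last first.
  apply: (@realizable_of_grading c0 c1 e0 e1 (q^-1 *: w)) => //.
    by move=> x x0 x1; rewrite brE wq // scalerA mulVf // scale1r.
  rewrite scaler_eq0 invr_eq0 (negPf q0) /=; apply/eqP => w0.
  move/eqP: w1; rewrite w0 brE eq_sym scaler_eq0 (negPf q0) /= => /eqP; exact/eqP.
have n0 : s * s + t * t != 0.
  by rewrite -!expr2 paddr_eq0 ?sqr_ge0 // !sqrf_eq0 negb_and.
pose chi := t *: c0 - s *: c1.
(* [m] is the component of the [e0], [e1] part of [x] along [w]; on [ker chi] it is all
   there is. *)
have w_decomp x : ev chi x = 0 -> exists m k,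
    [/\ x = m *: w + k, ev c0 k = 0 & ev c1 k = 0].
  rewrite !evE => /eqP; rewrite subr_eq0 => /eqP chix.
  have [m mE] : exists m, m * (s * s + t * t) = s * ev c0 x + t * ev c1 x.
    by eexists; exact: (divfK n0).
  have h1 : t * (t * ev c0 x) = t * (s * ev c1 x) by rewrite chix.
  have h2 : s * (t * ev c0 x) = s * (s * ev c1 x) by rewrite chix.
  have h3 : s * (m * (s * s + t * t)) = s * (s * ev c0 x + t * ev c1 x) by rewrite mE.
  have h4 : t * (m * (s * s + t * t)) = t * (s * ev c0 x + t * ev c1 x) by rewrite mE.
  exists m, (ev c2 x *: f1 + ev c3 x *: f2).
  rewrite !evE c02 c03 c12 c13; split; try ring.
  apply: (frame_inj fr); rewrite wE !evE ?(c00, c01, c02, c03, c10, c11, c12, c13)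
    ?(c20, c21, c22, c23, c30, c31, c32, c33).
  - by apply: (mulfI n0); lra.
  - by apply: (mulfI n0); lra.
  - by ring.
  - by ring.
apply: (@realizable_of_abelian chi (t *: e0 - s *: e1) f1) => //.
- by rewrite !evE c00 c01 c10 c11; apply: contra n0 => /eqP E; apply/eqP; rewrite -[RHS]E; ring.
- by move=> x y; rewrite !evE c0br c1br; ring.
- move=> x y /w_decomp[m [k [-> k0 k1]]] /w_decomp[m' [k' [-> k0' k1']]].
  by rewrite !brE !(brC hbr _ w) !wq // (ab k) // q0; vector_ring.
- by rewrite !evE c02 c12; ring.
Qed.

(** * Solvable ideals of dimension 3 *)

(** Here [e1], [f1] and [[e1, f1]] span a Heisenberg algebra; the last two are independent
because [ad e1] kills one and not the other. *)
Lemma realizable_of_nilpotent e0 e1 f1 f2 c0 c1 c2 c3 :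
  frame e0 e1 f1 f2 c0 c1 c2 c3 -> (forall x y, ev c0 [x, y] = 0) ->
  [e1, f1] != 0 -> [e1, [e1, f1]] = 0 -> [f1, [e1, f1]] = 0 ->
  ev c1 [e1, f1] = 0 -> realizable br.
Proof.
move=> fr c0br h0 e1h f1h c1h; set h := [e1, f1] in h0 e1h f1h c1h.
have [[c00 c01 c02 c03] [c10 c11 c12 c13]] := (frame0 fr, frame1 fr).
have [|d0 [d1 [d2 [d3 fr']]]] := @frame_of_basis R g e0 e1 f1 h dim4.
  move=> t0 t1 t2 t3 sum0.
  have t0_0 : t0 = 0.
    by have := congr1 (ev c0) sum0; rewrite !evE c00 c01 c02 c0br => <-; ring.
  have t1_0 : t1 = 0.
    by have := congr1 (ev c1) sum0; rewrite !evE c10 c11 c12 c1h => <-; ring.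
  have t2_0 : t2 = 0.
    have := congr1 (br e1) sum0; rewrite t0_0 t1_0 !brE e1h -/h !scaler0 !scale0r !add0r.
    by rewrite addr0 => /eqP; rewrite scaler_eq0 (negPf h0) orbF => /eqP.
  move: sum0; rewrite t0_0 t1_0 t2_0 !scale0r !add0r => /eqP.
  by rewrite scaler_eq0 (negPf h0) orbF => /eqP.
apply: (realizable_of_heisenberg fr') => // x y.
have c0E z : ev c0 z = ev d0 z.
  by rewrite {1}(frameE fr' z) !evE c00 c01 c02 c0br; ring.
by rewrite -c0E.
Qed.

(** Let [m] be the matrix of [ad e1] on the plane of [f1] and [f2], and let the column
[n] and the matrix [d] be the [e1]-component and the plane component of [ad e0] on the
same plane; let [l] be the [e1]-component of [[e0, e1]]. The Jacobi identity gives
[m n = 0], the equality of [n1] times the second row of [m] and [n2] times the first,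
and [m d - d m = l m]. Hence the trace and the determinant of [m] both annihilate [n],
and [l tr m = l tr (m ^ 2) = 0]. Unless [m] is nilpotent, [l = 0] and [n = 0], which
means that all brackets lie in the plane. *)
Lemma realizable_of_solvable e0 e1 f1 f2 c0 c1 c2 c3 :
  frame e0 e1 f1 f2 c0 c1 c2 c3 -> (forall x y, ev c0 [x, y] = 0) ->
  [f1, f2] = 0 -> ev c1 [e1, f1] = 0 -> ev c1 [e1, f2] = 0 -> realizable br.
Proof.
move=> fr c0br f12 c1_1 c1_2.
have [[c00 c01 c02 c03] [c10 c11 c12 c13]] := (frame0 fr, frame1 fr).
have [[c20 c21 c22 c23] [c30 c31 c32 c33]] := (frame2 fr, frame3 fr).
have cE := (c00, c01, c02, c03, c10, c11, c12, c13, c20, c21, c22, c23, c30, c31, c32, c33).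
have f21 : [f2, f1] = 0 by rewrite (brC hbr) f12 oppr0.
have hE x : ev c0 x = 0 -> x = ev c1 x *: e1 + ev c2 x *: f1 + ev c3 x *: f2.
  by move=> x0; rewrite {1}(frameE fr x) x0 scale0r add0r.
have kE x : ev c0 x = 0 -> ev c1 x = 0 -> x = ev c2 x *: f1 + ev c3 x *: f2.
  by move=> x0 x1; rewrite {1}(hE x) // x1 scale0r add0r.
have [m1 [m2 e1f1]] : exists m1 m2, [e1, f1] = m1 *: f1 + m2 *: f2.
  by eexists; eexists; apply: kE.
have [m3 [m4 e1f2]] : exists m3 m4, [e1, f2] = m3 *: f1 + m4 *: f2.
  by eexists; eexists; apply: kE.
have f1e1 : [f1, e1] = - (m1 *: f1 + m2 *: f2) by rewrite (brC hbr) e1f1.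
have f2e1 : [f2, e1] = - (m3 *: f1 + m4 *: f2) by rewrite (brC hbr) e1f2.
have [l [l2 [l3 e01]]] : exists l l2 l3, [e0, e1] = l *: e1 + l2 *: f1 + l3 *: f2.
  by do 3 eexists; apply: hE.
have [n1 [d1 [d2 e0f1]]] : exists n1 d1 d2, [e0, f1] = n1 *: e1 + d1 *: f1 + d2 *: f2.
  by do 3 eexists; apply: hE.
have [n2 [d3 [d4 e0f2]]] : exists n2 d3 d4, [e0, f2] = n2 *: e1 + d3 *: f1 + d4 *: f2.
  by do 3 eexists; apply: hE.
have [j1 j2] : n1 * m3 = n2 * m1 /\ n1 * m4 = n2 * m2.
  have := jacobi hbr e0 f1 f2; rewrite e0f1 e0f2 !brE f12 e1f2 f1e1 !brE => E.
  have := congr1 (ev c2) E; have := congr1 (ev c3) E; rewrite !evE !cE.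
  by move=> E3 E2; split; lra.
have [j3 j4 j5] : [/\ m1 * n1 + m2 * n2 = 0, m2 * d3 = l * m1 + d2 * m3 &
    m1 * d2 + m2 * d4 = l * m2 + d1 * m2 + d2 * m4].
  have := jacobi hbr e0 e1 f1; rewrite e01 e1f1 e0f1 !brE e0f1 e0f2 f21 e1f1 e1f2 => E.
  have := congr1 (ev c1) E; have := congr1 (ev c2) E; have := congr1 (ev c3) E.
  by rewrite !evE !cE => E3 E2 E1; split; lra.
have [j6 j7 j8] : [/\ m3 * n1 + m4 * n2 = 0, m3 * d2 = l * m4 + d3 * m2 &
    m3 * d1 + m4 * d3 = l * m3 + d3 * m1 + d4 * m3].
  have := jacobi hbr e0 e1 f2; rewrite e01 e1f2 e0f2 !brE e0f1 e0f2 f12 e1f1 e1f2 => E.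
  have := congr1 (ev c1) E; have := congr1 (ev c2) E; have := congr1 (ev c3) E.
  by rewrite !evE !cE => E3 E2 E1; split; lra.
have plane : l = 0 -> n1 = 0 -> n2 = 0 -> realizable br.
  move=> l_0 n1_0 n2_0; apply: (realizable_of_abelian_plane fr) => //.
  apply: (alternating_frame0 (F := fun x y => (ev c1 [x, y] : R^o)) fr).
  - by move=> x t y z; rewrite !brE !evE.
  - by move=> x; rewrite brE evE.
  - by move=> x y; rewrite (brC hbr) evE.
  - by rewrite e01 !evE !cE l_0; ring.
  - by rewrite e0f1 !evE !cE n1_0; ring.
  - by rewrite e0f2 !evE !cE n2_0; ring.
  - by [].
  - by [].
  - by rewrite f12 evE.
have [tr0|tr0] := eqVneq (m1 + m4) 0; last first.
  apply: plane; apply: (mulIf tr0); rewrite mul0r.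
  - by lra.
  - by lra.
  - by lra.
have m4E : m4 = - m1 by lra.
have [det0|det0] := eqVneq (m1 * m4 - m2 * m3) 0; last first.
  apply: plane; apply: (mulIf det0); rewrite mul0r.
  - have := congr1 ( *%R m1) j4; have := congr1 ( *%R m3) j5.
    have := congr1 ( *%R m4) j7; have := congr1 ( *%R m2) j8.
    by rewrite m4E /=; lra.
  - by have := congr1 ( *%R m4) j3; have := congr1 ( *%R m2) j6; rewrite /=; lra.
  - by have := congr1 ( *%R m3) j3; have := congr1 ( *%R m1) j6; rewrite /=; lra.
have sq0 : m1 * m1 + m2 * m3 = 0 by rewrite m4E in det0; lra.
have [h1|h1] := eqVneq [e1, f1] 0; last first.
  apply: (realizable_of_nilpotent fr) => //; rewrite e1f1 !brE ?e1f1 ?e1f2 ?f12 ?m4E.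
    rewrite -[RHS](scale0r f1) -sq0; vector_ring.
  by vector_ring.
have [h2|h2] := eqVneq [e1, f2] 0; last first.
  apply: (realizable_of_nilpotent (frame_swap fr)) => //; rewrite e1f2 !brE ?e1f1 ?e1f2 ?f21 ?m4E.
    rewrite -[RHS](scale0r f2) -sq0; vector_ring.
  by vector_ring.
apply: (@realizable_of_abelian c0 e0 f1) => //.
- by rewrite c00 oner_eq0.
- move=> x y x0 y0; rewrite (hE x) // (hE y) // !brE (brC hbr f1 e1) (brC hbr f2 e1) h1 h2 f12 f21.
  vector_ring.
- by apply/eqP => f1_0; move: c22; rewrite f1_0 evE; apply/eqP; rewrite eq_sym oner_eq0.
Qed.

(** A functional [c1] killing the brackets of [h = ker c0] cuts out a plane containing
[[h, h]]. If this plane is not abelian, it has a basis with [[a, f] = f]; every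
derivation of it is then inner, so [h] contains an element [c = e1 - m4 *: a] commuting
with [f], and the plane of [c] and [f] is an abelian ideal of [h] that can be used
instead. *)
Lemma realizable_of_not_perfect_ideal (c0 c1 : 'Hom(g, R^o)) e y :
  ev c0 e != 0 -> (forall x y, ev c0 [x, y] = 0) -> ev c0 y = 0 -> ev c1 y != 0 ->
  (forall x y, ev c0 x = 0 -> ev c0 y = 0 -> ev c1 [x, y] = 0) -> realizable br.
Proof.
move=> c0e c0br c0y c1y c1br.
have [e0 [e1 [f1 [f2 [c2 [c3 fr]]]]]] := adapted_frame dim4 c0e c0y c1y.
have [[c00 c01 c02 c03] [c10 c11 c12 c13]] := (frame0 fr, frame1 fr).
have [f0|f0] := eqVneq [f1, f2] 0.
  by apply: (realizable_of_solvable fr) => //; apply: c1br.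
have [f fE] : exists f, f = [f1, f2] by eexists.
rewrite -fE in f0.
have [p [s f12]] : exists p s, f = p *: f1 + s *: f2.
  by do 2 eexists; rewrite [LHS](frameE fr) fE c0br c1br // !scale0r !add0r.
have n0 : s * s + p * p != 0.
  apply: contra f0; rewrite -!expr2 paddr_eq0 ?sqr_ge0 // !sqrf_eq0 => /andP[/eqP s0 /eqP p0].
  by rewrite f12 s0 p0 !scale0r addr0.
(* Bracketing [f1] and [f2] with [f] multiplies it by [s] and [- p]. *)
have [a aE] : exists a, a = (s * s + p * p)^-1 *: (s *: f1 - p *: f2) by eexists.
have af : [a, f] = f.
  rewrite f12 aE !brE (brC hbr f2 f1) -fE [in RHS](_ : p *: f1 + s *: f2 = f) //.
  by apply: ev_inj => h; rewrite !evE; field.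
have [a_0 a_1] : ev c0 a = 0 /\ ev c1 a = 0 by rewrite aE !evE c02 c03 c12 c13; split; ring.
have [f_0 f_1] : ev c0 f = 0 /\ ev c1 f = 0 by rewrite fE c0br c1br.
have [|d0 [d1 [d2 [d3 fr']]]] := @frame_of_basis R g e0 e1 a f dim4.
  move=> t0 t1 t2 t3 sum0.
  have t0_0 : t0 = 0.
    by have := congr1 (ev c0) sum0; rewrite !evE c00 c01 a_0 f_0 => <-; ring.
  have t1_0 : t1 = 0.
    by have := congr1 (ev c1) sum0; rewrite !evE c10 c11 a_1 f_1 => <-; ring.
  have t3_0 : t3 = 0.
    have := congr1 (br a) sum0; rewrite t0_0 t1_0 !brE af !scaler0 !scale0r !add0r.
    by move=> /eqP; rewrite scaler_eq0 (negPf f0) orbF => /eqP.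
  have t2_0 : t2 = 0.
    have := congr1 (br^~ f) sum0; rewrite t0_0 t1_0 t3_0 !brE af !scale0r !add0r addr0.
    by move=> /eqP; rewrite scaler_eq0 (negPf f0) orbF => /eqP.
  by [].
have c0E x : ev c0 x = ev d0 x.
  by rewrite {1}(frameE fr' x) !evE c00 c01 a_0 f_0; ring.
have c1E x : ev c1 x = ev d1 x.
  by rewrite {1}(frameE fr' x) !evE c10 c11 a_1 f_1; ring.
have [[d20 d21 d22 d23] [d30 d31 d32 d33]] := (frame2 fr', frame3 fr').
have kE x y' : ev c0 x = 0 -> ev c0 y' = 0 -> [x, y'] = ev d2 [x, y'] *: a + ev d3 [x, y'] *: f.
  move=> x0 y0; rewrite {1}(frameE fr' [x, y']) -c0E -c1E c0br c1br //.
  by rewrite !scale0r !add0r.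
have [m1 [m2 e1a]] : exists m1 m2, [e1, a] = m1 *: a + m2 *: f.
  by do 2 eexists; apply: kE.
have [m3 [m4 e1f]] : exists m3 m4, [e1, f] = m3 *: a + m4 *: f.
  by do 2 eexists; apply: kE.
have [m1_0 m3_0] : m1 = 0 /\ m3 = 0.
  have := jacobi hbr e1 a f; rewrite af e1f e1a !brE af => E.
  have := congr1 (ev d2) E; have := congr1 (ev d3) E; rewrite !evE d22 d23 d32 d33.
  by move=> E3 E2; split; lra.
have [[d00 d01 d02 d03] [d10 d11 d12 d13]] := (frame0 fr', frame1 fr').
(* The element [e1 - m4 *: a] commutes with [f] because [m1 = m3 = 0]. *)
have fr'' : frame e0 a (e1 - m4 *: a) f d0 (d2 + m4 *: d1) d1 d3.
  split; rewrite ?evE ?(d00, d01, d02, d03, d10, d11, d12, d13, d20, d21, d22, d23, d30, d31, d32, d33).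
  - move=> x; rewrite {1}(frameE fr' x) !evE; vector_ring.
  - by split; ring.
  - by split; ring.
  - by split; ring.
  - by split; ring.
apply: (realizable_of_solvable fr'').
- by move=> x y'; rewrite -c0E.
- by rewrite !brE e1f af m3_0; vector_ring.
- by rewrite !brE (brC hbr a e1) e1a m1_0 !evE d12 d13 d22 d23; ring.
- by rewrite af !evE d13 d23; ring.
Qed.

(** * Perfect ideals of dimension 3 *)

(** In the basis [x], [y], [z = [x, y]], the Jacobi identity together with perfectness
puts [[y, z]] and [[z, x]] in the span of [x] and [y], and makes them independent. So
[z] does not lie in [[h, z]], and the twist [k] can be adjusted so that
[[e0, z] + k *: z] does not either. An element of g killing [z] in the twisted action
is then in [h] and proportional to [z], hence does not kill [x]. *)
Lemma realizable_of_simple e0 x y z c0 c1 c2 c3 :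
  frame e0 x y z c0 c1 c2 c3 -> (forall x y, ev c0 [x, y] = 0) -> [x, y] = z ->
  (forall c, (forall x y, ev c0 x = 0 -> ev c0 y = 0 -> ev c [x, y] = 0) ->
     forall y, ev c0 y = 0 -> ev c y = 0) ->
  realizable br.
Proof.
move=> fr c0br xy perf.
have [[c00 c01 c02 c03] [c10 c11 c12 c13]] := (frame0 fr, frame1 fr).
have [[c20 c21 c22 c23] [c30 c31 c32 c33]] := (frame2 fr, frame3 fr).
have cE := (c00, c01, c02, c03, c10, c11, c12, c13, c20, c21, c22, c23, c30, c31, c32, c33).
have hE u : ev c0 u = 0 -> u = ev c1 u *: x + ev c2 u *: y + ev c3 u *: z.
  by move=> u0; rewrite {1}(frameE fr u) u0 scale0r add0r.
have perf' c : ev c z = 0 -> ev c [y, z] = 0 -> ev c [z, x] = 0 -> ev c x = 0 /\ ev c y = 0.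
  move=> cz cyz czx; split; apply: perf => // u v u0 v0;
    rewrite (hE u) // (hE v) // !brE (brC hbr y x) (brC hbr z y) (brC hbr x z) xy;
    by rewrite !evE cz cyz czx; ring.
have [n11 [n12 [n13 yz]]] : exists a b c, [y, z] = a *: x + b *: y + c *: z.
  by do 3 eexists; apply: hE.
have [n21 [n22 [n23 zx]]] : exists a b c, [z, x] = a *: x + b *: y + c *: z.
  by do 3 eexists; apply: hE.
have det0 : n11 * n22 - n12 * n21 != 0.
  apply/eqP => det0.
  have [] := perf' (n12 *: c1 - n11 *: c2); rewrite ?yz ?zx ?evE ?cE; try by lra.
  move=> n12_0 n11_0.
  have [] := perf' (n22 *: c1 - n21 *: c2); rewrite ?yz ?zx ?evE ?cE; try by lra.
  move=> n22_0 n21_0.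
  have [] := perf' c1; rewrite ?yz ?zx ?evE ?cE; try by lra.
have [j1 j2] : n13 * n21 = n23 * n11 /\ n13 * n22 = n23 * n12.
  have := jacobi hbr x y z; rewrite yz xy (brC hbr x z) zx !brE (brC hbr x z) (brC hbr y x) xy yz zx => E.
  have := congr1 (ev c1) E; have := congr1 (ev c2) E; rewrite !evE !cE.
  by move=> E2 E1; split; lra.
(* The Jacobi identity is a linear relation between the independent [[y, z]], [[z, x]]. *)
have n13_0 : n13 = 0.
  apply: (mulIf det0); rewrite mul0r.
  by have := congr1 ( *%R n12) j1; have := congr1 ( *%R n11) j2; rewrite /=; lra.
have n23_0 : n23 = 0.
  apply: (mulIf det0); rewrite mul0r.
  by have := congr1 ( *%R n22) j1; have := congr1 ( *%R n21) j2; rewrite /=; lra.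
pose k := 1 - ev c3 [e0, z].
pose act u w := [u, w] + (k * ev c0 u) *: w.
have actr u : linear (act u) by move=> t v w; rewrite /act !brE; vector_ring.
have actl w : linear (act^~ w) by move=> t u v; rewrite /act !brE; vector_ring.
have actM u v w : act [u, v] w = act u (act v w) - act v (act u w).
  by rewrite /act c0br !brE (jacobi hbr u v w); vector_ring.
have act_h u w : ev c0 w = 0 -> ev c0 (act u w) = 0.
  by move=> w0; rewrite /act !evE c0br w0; ring.
apply: (realizable_on_hyperplane (br := br) (chi := c0) (act := act) (b1 := fun u => act u z)
  (b2 := fun u => act u x)) => //.
- by apply: (@ev_neq0 _ _ _ e0); rewrite c00 oner_eq0.
- by move=> u; apply: act_h.
- by move=> u; apply: act_h.
- move=> u uz ux.
  have xz : [x, z] = - [z, x] by rewrite (brC hbr).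
  have u0 : ev c0 u = 0.
    have := congr1 (ev c3) uz; rewrite /act (frameE fr u) !brE xz yz zx n13_0 n23_0.
    by rewrite !evE !cE /k => E; lra.
  move: uz ux; rewrite /act u0 (hE u) // !brE mulr0 !scale0r !addr0 xz yz zx n13_0 n23_0 => uz ux.
  have E1 := congr1 (ev c1) uz; have E2 := congr1 (ev c2) uz.
  rewrite !evE !cE in E1 E2.
  have u1 : ev c1 u = 0.
    apply: (mulIf det0); have := congr1 ( *%R n12) E1; have := congr1 ( *%R n11) E2.
    by rewrite /=; lra.
  have u2 : ev c2 u = 0.
    apply: (mulIf det0); have := congr1 ( *%R n22) E1; have := congr1 ( *%R n21) E2.
    by rewrite /=; lra.
  have F1 := congr1 (ev c1) ux; have F2 := congr1 (ev c2) ux.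
  rewrite u2 !evE !cE in F1 F2.
  have u3 : ev c3 u = 0.
    apply: (mulIf det0); have := congr1 ( *%R n12) F1; have := congr1 ( *%R n11) F2.
    by rewrite /=; lra.
  by rewrite u1 u2 u3 !scale0r !addr0.
Qed.

(** The functionals [m], [p] and [q] witness that [x], [y] and [[x, y]] are independent. *)
Lemma realizable_of_generic_pair (c0 m p q : 'Hom(g, R^o)) e x y :
  ev c0 e = 1 -> (forall x y, ev c0 [x, y] = 0) ->
  (forall c, (forall x y, ev c0 x = 0 -> ev c0 y = 0 -> ev c [x, y] = 0) ->
     forall y, ev c0 y = 0 -> ev c y = 0) ->
  ev c0 x = 0 -> ev c0 y = 0 -> ev p x = 1 -> ev p y = 0 -> ev q x = 0 -> ev q y = 1 ->
  ev m x = 0 -> ev m y = 0 -> ev m [x, y] != 0 -> realizable br.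
Proof.
move=> c0e c0br perf x0 y0 px py qx qy mx my mxy.
have [|d0 [d1 [d2 [d3 fr]]]] := @frame_of_basis R g e x y [x, y] dim4.
  move=> t0 t1 t2 t3 sum0.
  have t0_0 : t0 = 0.
    by have := congr1 (ev c0) sum0; rewrite !evE c0e x0 y0 c0br => <-; ring.
  have t3_0 : t3 = 0.
    have := congr1 (ev m) sum0; rewrite t0_0 !evE mx my => E; apply: (mulIf mxy); lra.
  have t1_0 : t1 = 0.
    by have := congr1 (ev p) sum0; rewrite t0_0 t3_0 !evE px py => <-; ring.
  have t2_0 : t2 = 0.
    by have := congr1 (ev q) sum0; rewrite t0_0 t3_0 !evE qx qy => <-; ring.
  by [].
have c0E : c0 = d0.
  apply/lfunP => u; rewrite -[LHS]/(ev c0 u) {1}(frameE fr u) !(evD, evZ).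
  by rewrite c0e x0 y0 c0br -[RHS]/(ev d0 u); ring.
by rewrite c0E in c0br perf; apply: (realizable_of_simple fr).
Qed.

(** If [[x, y]] lay in the span of [x] and [y] for all [x], [y] in [h], the matrix of the
bracket in the bases [e1, e2, e3] and [[e2, e3], [e3, e1], [e1, e2]] would be
antisymmetric, hence singular, against perfectness. Six pairs suffice to test
antisymmetry. *)
Lemma realizable_of_perfect_ideal (c0 : 'Hom(g, R^o)) e :
  ev c0 e != 0 -> (forall x y, ev c0 [x, y] = 0) ->
  (forall c, (forall x y, ev c0 x = 0 -> ev c0 y = 0 -> ev c [x, y] = 0) ->
     forall y, ev c0 y = 0 -> ev c y = 0) ->
  realizable br.
Proof.
move=> c0e c0br perf.
have [y [y0 c0y]] : exists y, y != 0 /\ ev c0 y = 0.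
  exists (vpick (lker c0)); split; last by have := memv_pick (lker c0); rewrite memv_ker => /eqP.
  by rewrite vpick0 -dimv_eq0 (dim_lker dim4 (ev_neq0 c0e)).
have [c1 c1y] : exists c1 : 'Hom(g, R^o), ev c1 y != 0.
  apply: contrapT => /forallNP c_y; case/eqP: y0; apply: ev_inj => f.
  by have /negP := c_y f; rewrite negbK evE => /eqP.
have [e0 [e1 [e2 [e3 [c2 [c3 fr]]]]]] := adapted_frame dim4 c0e c0y c1y.
have [[c00 c01 c02 c03] [c10 c11 c12 c13]] := (frame0 fr, frame1 fr).
have [[c20 c21 c22 c23] [c30 c31 c32 c33]] := (frame2 fr, frame3 fr).
have cE := (c00, c01, c02, c03, c10, c11, c12, c13, c20, c21, c22, c23, c30, c31, c32, c33).
have hE u : ev c0 u = 0 -> u = ev c1 u *: e1 + ev c2 u *: e2 + ev c3 u *: e3.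
  by move=> u0; rewrite {1}(frameE fr u) u0 scale0r add0r.
have [n11 [n12 [n13 b1]]] : exists a b c, [e2, e3] = a *: e1 + b *: e2 + c *: e3.
  by do 3 eexists; apply: hE.
have [n21 [n22 [n23 b2]]] : exists a b c, [e3, e1] = a *: e1 + b *: e2 + c *: e3.
  by do 3 eexists; apply: hE.
have [n31 [n32 [n33 b3]]] : exists a b c, [e1, e2] = a *: e1 + b *: e2 + c *: e3.
  by do 3 eexists; apply: hE.
have pair (m p q : 'Hom(g, R^o)) x y := @realizable_of_generic_pair c0 m p q e0 x y c00 c0br perf.
have [n11_0|n11_0] := eqVneq n11 0; last first.
  apply: (pair c1 c2 c3 e2 e3) => //; rewrite b1 !evE ?cE.
  by rewrite !mulr0 !addr0 mulr1.
have [n22_0|n22_0] := eqVneq n22 0; last first.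
  apply: (pair c2 c3 c1 e3 e1) => //; rewrite b2 !evE ?cE.
  by rewrite !mulr0 addr0 add0r mulr1.
have [n33_0|n33_0] := eqVneq n33 0; last first.
  apply: (pair c3 c1 c2 e1 e2) => //; rewrite b3 !evE ?cE.
  by rewrite !mulr0 !add0r mulr1.
have [s12|s12] := eqVneq (n12 + n21) 0; last first.
  apply: (pair (c1 + c2) c3 (- c2) e3 (e1 - e2)); rewrite ?evE ?cE; try ring.
  apply: contra s12 => /eqP E; apply/eqP; rewrite -[RHS]E !brE (brC hbr e3 e2) b1 b2 !evE !cE.
  by rewrite n11_0 n22_0; ring.
have [s23|s23] := eqVneq (n23 + n32) 0; last first.
  apply: (pair (c2 + c3) c1 (- c3) e1 (e2 - e3)); rewrite ?evE ?cE; try ring.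
  apply: contra s23 => /eqP E; apply/eqP; rewrite -[RHS]E !brE (brC hbr e1 e3) b2 b3 !evE !cE.
  by rewrite n22_0 n33_0; ring.
have [s13|s13] := eqVneq (n13 + n31) 0; last first.
  apply: (pair (c1 + c3) c2 (- c1) e2 (e3 - e1)); rewrite ?evE ?cE; try ring.
  apply: contra s13 => /eqP E; apply/eqP; rewrite -[RHS]E !brE (brC hbr e2 e1) b1 b3 !evE !cE.
  by rewrite n11_0 n33_0; ring.
have perf' c : ev c [e2, e3] = 0 -> ev c [e3, e1] = 0 -> ev c [e1, e2] = 0 ->
    [/\ ev c e1 = 0, ev c e2 = 0 & ev c e3 = 0].
  move=> cb1 cb2 cb3; split; apply: perf => // u v u0 v0;
    rewrite (hE u) // (hE v) // !brE (brC hbr e2 e1) (brC hbr e3 e2) (brC hbr e1 e3);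
    by rewrite !evE cb1 cb2 cb3; ring.
have n21E : n21 = - n12 by lra.
have n32E : n32 = - n23 by lra.
have n13E : n13 = - n31 by lra.
have [] : [/\ ev (n23 *: c1 + n31 *: c2 + n12 *: c3) e1 = 0,
    ev (n23 *: c1 + n31 *: c2 + n12 *: c3) e2 = 0 &
    ev (n23 *: c1 + n31 *: c2 + n12 *: c3) e3 = 0].
  by apply: perf'; rewrite ?b1 ?b2 ?b3 !evE ?cE ?n11_0 ?n22_0 ?n33_0 ?n21E ?n32E ?n13E; ring.
rewrite !evE !cE => E1 E2 E3.
have [E _ _] : [/\ ev c1 e1 = 0, ev c1 e2 = 0 & ev c1 e3 = 0].
  apply: perf'; rewrite ?b1 ?b2 ?b3 !evE ?cE ?n11_0 ?n22_0 ?n33_0 ?n21E ?n32E ?n13E; lra.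
by move: E; rewrite c11 => /eqP; rewrite oner_eq0.
Qed.

Lemma realizable_of_character (c0 : 'Hom(g, R^o)) e :
  ev c0 e != 0 -> (forall x y, ev c0 [x, y] = 0) -> realizable br.
Proof.
move=> c0e c0br.
have [perf|/existsNP[c1 /not_implyP[c1br /existsNP[y /not_implyP[y0 /eqP c1y]]]]] := pselect
  (forall c, (forall x y, ev c0 x = 0 -> ev c0 y = 0 -> ev c [x, y] = 0) ->
     forall y, ev c0 y = 0 -> ev c y = 0).
  exact: realizable_of_perfect_ideal c0e c0br perf.
exact: (realizable_of_not_perfect_ideal c0e c0br y0 c1y c1br).
Qed.

(** * Algebras of dimension 4 are not perfect *)

Section Frame.
Variables (e0 e1 e2 e3 : g) (c0 c1 c2 c3 : 'Hom(g, R^o)).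
Hypothesis fr : frame e0 e1 e2 e3 c0 c1 c2 c3.

Definition tr_ad x := ev c0 [x, e0] + ev c1 [x, e1] + ev c2 [x, e2] + ev c3 [x, e3].

Lemma tr_ad_br x y : tr_ad [x, y] = 0.
Proof.
have jac z : [[x, y], z] = [x, [y, z]] - [y, [x, z]] by rewrite (jacobi hbr x y) addrK.
have E c u v : ev c [u, v] = ev c0 v * ev c [u, e0] + ev c1 v * ev c [u, e1]
    + ev c2 v * ev c [u, e2] + ev c3 v * ev c [u, e3].
  by rewrite {1}(frameE fr v) !brE !evE.
rewrite /tr_ad !jac !evE !(E _ x [y, _]) !(E _ y [x, _]); ring.
Qed.

(** This is [d alpha /\ d beta = d (alpha /\ d beta) = 0] evaluated on the frame, the last
equality holding because [tr_ad] vanishes. The left-hand side is linear in the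
values of [alpha] on the frame; the coefficient of the value on one of the vectors vanishes by
the Jacobi identity of the other three and the vanishing of the traces. *)
Lemma wedge_eq0 (alpha beta : 'Hom(g, R^o)) : (forall x, tr_ad x = 0) ->
  ev alpha [e0, e1] * ev beta [e2, e3] - ev alpha [e0, e2] * ev beta [e1, e3]
  + ev alpha [e0, e3] * ev beta [e1, e2] + ev alpha [e1, e2] * ev beta [e0, e3]
  - ev alpha [e1, e3] * ev beta [e0, e2] + ev alpha [e2, e3] * ev beta [e0, e1] = 0.
Proof.
move=> tr0; have exp u : exists a b c d, u = a *: e0 + b *: e1 + c *: e2 + d *: e3.
  by do 4 eexists; apply: (frameE fr).
have [[c00 c01 c02 c03] [c10 c11 c12 c13]] := (frame0 fr, frame1 fr).
have [[c20 c21 c22 c23] [c30 c31 c32 c33]] := (frame2 fr, frame3 fr).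
have cE := (c00, c01, c02, c03, c10, c11, c12, c13, c20, c21, c22, c23, c30, c31, c32, c33).
have [p0 [p1 [p2 [p3 b01]]]] := exp [e0, e1].
have [q0 [q1 [q2 [q3 b02]]]] := exp [e0, e2].
have [r0 [r1 [r2 [r3 b03]]]] := exp [e0, e3].
have [s0 [s1 [s2 [s3 b12]]]] := exp [e1, e2].
have [t0 [t1 [t2 [t3 b13]]]] := exp [e1, e3].
have [u0 [u1 [u2 [u3 b23]]]] := exp [e2, e3].
have [b10 b20 b30] : [/\ [e1, e0] = - [e0, e1], [e2, e0] = - [e0, e2] &
    [e3, e0] = - [e0, e3]] by split; exact: brC.
have [b21 b31 b32] : [/\ [e2, e1] = - [e1, e2], [e3, e1] = - [e1, e3] &
    [e3, e2] = - [e2, e3]] by split; exact: brC.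
have trE := (b10, b20, b30, b21, b31, b32, b01, b02, b03, b12, b13, b23).
have p0E : p0 = s2 + t3.
  by have := tr0 e1; rewrite /tr_ad (brxx hbr) !trE !evE !cE => T; lra.
have q0E : q0 = u3 - s1.
  by have := tr0 e2; rewrite /tr_ad (brxx hbr) !trE !evE !cE => T; lra.
have r0E : r0 = - t1 - u2.
  by have := tr0 e3; rewrite /tr_ad (brxx hbr) !trE !evE !cE => T; lra.
have p1E : p1 = - q2 - r3.
  by have := tr0 e0; rewrite /tr_ad (brxx hbr) !trE !evE !cE => T; lra.
have jac x y z : ev beta [[x, y], z] = ev beta [x, [y, z]] - ev beta [y, [x, z]].
  by rewrite (jacobi hbr x y) evE addrK.
set B01 := ev beta [e0, e1]; set B02 := ev beta [e0, e2]; set B03 := ev beta [e0, e3].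
set B12 := ev beta [e1, e2]; set B13 := ev beta [e1, e3]; set B23 := ev beta [e2, e3].
have Q0 : p0 * B23 - q0 * B13 + r0 * B12 + s0 * B03 - t0 * B02 + u0 * B01 = 0.
  have := jac e1 e2 e3; rewrite b12 b13 b23 !brE ?(b10, b20, b30, b21, b31, b32) !evE.
  rewrite -/B01 -/B02 -/B03 -/B12 -/B13 -/B23 p0E q0E r0E => J; lra.
have Q1 : p1 * B23 - q1 * B13 + r1 * B12 + s1 * B03 - t1 * B02 + u1 * B01 = 0.
  have := jac e0 e2 e3; rewrite b02 b03 b23 !brE ?(b10, b20, b30, b21, b31, b32) !evE.
  rewrite -/B01 -/B02 -/B03 -/B12 -/B13 -/B23 q0E r0E p1E => J; lra.
have Q2 : p2 * B23 - q2 * B13 + r2 * B12 + s2 * B03 - t2 * B02 + u2 * B01 = 0.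
  have := jac e0 e1 e3; rewrite b01 b03 b13 !brE ?(b10, b20, b30, b21, b31, b32) !evE.
  rewrite -/B01 -/B02 -/B03 -/B12 -/B13 -/B23 p0E r0E p1E => J; lra.
have Q3 : p3 * B23 - q3 * B13 + r3 * B12 + s3 * B03 - t3 * B02 + u3 * B01 = 0.
  have := jac e0 e1 e2; rewrite b01 b02 b12 !brE ?(b10, b20, b30, b21, b31, b32) !evE.
  rewrite -/B01 -/B02 -/B03 -/B12 -/B13 -/B23 p0E q0E p1E => J; lra.
transitivity (ev alpha e0 * 0 + ev alpha e1 * 0 + ev alpha e2 * 0 + ev alpha e3 * 0); last by ring.
rewrite -{1}Q0 -{1}Q1 -{1}Q2 -{1}Q3; clearbody B01 B02 B03 B12 B13 B23.
by rewrite b01 b02 b03 b12 b13 b23 !evE; ring.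
Qed.

End Frame.

(** In the unimodular case, if no nonzero functional killed all brackets, the
functionals would embed in the 2-forms as a 4 x 6 matrix [M] of rank 4 with
[M' *m M^T = 0], where [M'] lists the same 2-forms in the dual coordinates for the wedge
product; the ranks of [M'] and [M] would add up to at most 6. *)
Lemma exists_character :
  exists (c : 'Hom(g, R^o)) e, ev c e != 0 /\ forall x y, ev c [x, y] = 0.
Proof.
have [e0 [e1 [e2 [e3 [c0 [c1 [c2 [c3 fr]]]]]]]] := exists_frame dim4.
have [[c00 c01 c02 c03] [c10 c11 c12 c13]] := (frame0 fr, frame1 fr).
have [[c20 c21 c22 c23] [c30 c31 c32 c33]] := (frame2 fr, frame3 fr).
have cE := (c00, c01, c02, c03, c10, c11, c12, c13, c20, c21, c22, c23, c30, c31, c32, c33).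
have [T TE] : exists T : 'Hom(g, R^o), ev T =1 tr_ad e0 e1 e2 e3 c0 c1 c2 c3.
  by apply: functional => a x y; rewrite /tr_ad !brE !evE; ring.
have [[e Te]|/forallNP T0] := pselect (exists e, ev T e != 0).
  by exists T, e; split=> // x y; rewrite TE (tr_ad_br fr).
have {}T0 x : tr_ad e0 e1 e2 e3 c0 c1 c2 c3 x = 0.
  by rewrite -TE; apply/eqP; move/negP: (T0 x); rewrite negbK.
apply: contrapT => no_c.
pose B := [:: [e0, e1]; [e0, e2]; [e0, e3]; [e1, e2]; [e1, e3]; [e2, e3]].
pose B' := [:: [e2, e3]; - [e1, e3]; [e1, e2]; [e0, e3]; - [e0, e2]; [e0, e1]].
pose c (i : 'I_4) := [:: c0; c1; c2; c3]`_i.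
pose M : 'M[R]_(4, 6) := \matrix_(i, j) ev (c i) B`_j.
pose M' : 'M[R]_(4, 6) := \matrix_(i, j) ev (c i) B'`_j.
have MM' : M' *m M^T = 0.
  apply/matrixP => i j; rewrite !mxE -[RHS](wedge_eq0 fr (c i) (c j) T0).
  by rewrite !big_ord_recl big_ord0 !mxE /= !evE; ring.
have indep (v : 'rV_4) : (forall x, x \in B -> ev (\sum_i v 0 i *: c i) x = 0) -> v = 0.
  move=> vB; apply/eqP; apply: contrapT => /negP v0; apply: no_c.
  have sumE x : ev (\sum_i v 0 i *: c i) x = \sum_i v 0 i * ev (c i) x.
    by rewrite /ev sum_lfunE; apply: eq_bigr => i _; rewrite scale_lfunE.
  have [k vk] : exists k, v 0 k != 0.
    by case/rV0Pn: v0 => k; exists k.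
  exists (\sum_i v 0 i *: c i), [:: e0; e1; e2; e3]`_k; split.
    rewrite sumE (bigD1 k) //= big1 => [|i ik].
      by move: vk; case: k => [[|[|[|[|//]]]] ?] /=; rewrite /c /= ?cE addr0 mulr1.
    move: ik; rewrite /c -val_eqE /=; case: i k {vk} => [[|[|[|[|//]]]] ?] [[|[|[|[|//]]]] ?] //= _;
      by rewrite ?cE mulr0.
  apply: (alternating_frame0 (F := fun x y => (ev (\sum_i v 0 i *: c i) [x, y] : R^o)) fr);
    try by apply: vB; rewrite !inE eqxx ?orbT.
  - by move=> x t y z; rewrite !brE !evE.
  - by move=> x; rewrite brE evE.
  - by move=> x y; rewrite (brC hbr) evE.
have mulE (v : 'rV_4) (C : seq g) (j : 'I_6) : (v *m \matrix_(i < 4, j < 6) ev (c i) C`_j) 0 j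
    = ev (\sum_i v 0 i *: c i) C`_j.
  rewrite mxE /ev sum_lfunE; apply: eq_bigr => i _; by rewrite mxE scale_lfunE.
have M_free : row_free M.
  apply: inj_row_free => v vM; apply: indep => x /(nthP 0)[j j6 <-].
  by have := mulE v B (Ordinal j6); rewrite vM mxE => <-.
have M'_free : row_free M'.
  apply: inj_row_free => v vM; apply: indep => x.
  have vj (j : 'I_6) : ev (\sum_i v 0 i *: c i) B'`_j = 0 by rewrite -mulE vM mxE.
  have := (vj (@Ordinal 6 0 isT), vj (@Ordinal 6 1 isT), vj (@Ordinal 6 2 isT)).
  have := (vj (@Ordinal 6 3 isT), vj (@Ordinal 6 4 isT), vj (@Ordinal 6 5 isT)).
  rewrite /= !evN => -[[h3 h4] h5] [[h0 h1] h2].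
  by rewrite !inE => /or4P[/eqP->|/eqP->|/eqP->|/or3P[/eqP->|/eqP->|/eqP->]] //; lra.
have := mulmx0_rank_max MM'; rewrite mxrank_tr.
by move: M_free M'_free; rewrite /row_free => /eqP -> /eqP ->.
Qed.

Theorem realizable_dim4 : realizable br.
Proof.
have [c [e [ce cbr]]] := exists_character.
exact: realizable_of_character ce cbr.
Qed.

End Realizations.

(** * Realization by affine fields *)

Theorem theorem1p2 (R : realType) (g : vectType R) (br : g -> g -> g)
    (hbr : is_lie_bracket br) (hdim : \dim {:g} = 4%N) :
  exists (D : set 'rV[R[i]]_3) (phi : g -> 'rV[R[i]]_3 -> 'rV[R[i]]_3),
    [/\ is_domain D,
        affine_field_embedding br D phi &
        forall e : 4.-tuple g, basis_of {:g} e ->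
          forall z, D z -> real_independent (fun i => phi (tnth e i) z)].
Proof.
have [rho [b1 [b2 [rhoM b1M b2M b_inj]]]] := realizable_dim4 hbr hdim.
have [D [phi [D_domain phi_emb phi_indep]]] :=
  affine_fields_of_cocycles rhoM b1M b2M b_inj.
exists D, phi; split=> // e /basis_free e_free; exact: phi_indep.
Qed.
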